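(* There is no Noetherian, separable $C^*$-algebra that is both purely infinite and stably finite. In particular, there is no Noetherian purely infinite $AH_0$-algebra.
   Context: A $C^*$-algebra $A$ is Noetherian if it satisfies the ascending chain condition for closed ideals: for every ascending chain $I_1\subseteq I_2\subseteq\cdots$ of closed ideals of $A$ there is a positive integer $n$ with $I_i=I_n$ for all $i\ge n$. $A$ is purely infinite (Kirchberg--Rørdam) if it has no characters and for all $x,y\in A_+$ with $y$ in the closed two-sided ideal generated by $x$ there is a sequence $(a_n)$ in $A$ with $a_nxa_n^*\to y$. The remaining terms are used without definition in the source and have their usual meanings: $A$ is stably finite if no matrix algebra $M_n(A)$ contains an infinite projection (a projection Murray--von Neumann equivalent to a proper subprojection of itself); an $AH_0$-algebra is the inductive limit of a sequence of finite direct sums of $C^*$-algebras of the form $M_n(C_0(X\setminus\{x_0\}))$ with $X$ a connected compact metrizable space and $x_0\in X$. *)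

(* Defs.v *)
From HB Require Import structures.
From mathcomp Require Import all_boot all_order all_algebra.
From mathcomp Require Import all_classical all_reals all_analysis.
From mathcomp Require Import complex.

Set Implicit Arguments.
Unset Strict Implicit.
Unset Printing Implicit Defensive.

Import Order.TTheory GRing.Theory Num.Theory.
Import numFieldNormedType.Exports.

Local Open Scope classical_set_scope.
Local Open Scope ring_scope.
Local Open Scope complex_scope.

Reserved Notation "x ** y" (at level 40, left associativity).
Reserved Notation "x ^*s" (at level 1, format "x ^*s").

(* Complex *-algebras. They need not have a unit, so the ring structures of
   MathComp do not apply and the product is declared separately. *)
HB.mixin Record Lmodule_isStarAlgebra (R : realType) A
    of GRing.Lmodule R[i] A := {
  smul : A -> A -> A ;
  star : A -> A ;
  smulA : associative smul ;
  smulDl : left_distributive smul +%R ;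
  smulDr : right_distributive smul +%R ;
  smulZl : forall (c : R[i]) (x y : A), smul (c *: x) y = c *: smul x y ;
  smulZr : forall (c : R[i]) (x y : A), smul x (c *: y) = c *: smul x y ;
  starK : involutive star ;
  starD : {morph star : x y / x + y} ;
  starZ : forall (c : R[i]) (x : A), star (c *: x) = Num.conj c *: star x ;
  starM : forall x y : A, star (smul x y) = smul (star y) (star x)
}.

#[short(type="starAlgType")]
HB.structure Definition StarAlgebra (R : realType) :=
  {A of GRing.Lmodule R[i] A & Lmodule_isStarAlgebra R A}.

Notation "x ** y" := (smul x y) : ring_scope.
Notation "x ^*s" := (star x) : ring_scope.

(* The norm of a normed R[i]-module takes its (real, nonnegative) values in
   R[i]. *)
HB.mixin Record isCStarNorm (R : realType) A
    of CompleteNormedModule R[i] A & StarAlgebra R A := {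
  normr_smul_le : forall x y : A, `|x ** y| <= `|x| * `|y| ;
  normr_star_smul : forall x : A, `|x^*s ** x| = `|x| ^+ 2
}.

#[short(type="cstarAlgType")]
HB.structure Definition CStarAlgebra (R : realType) :=
  {A of CompleteNormedModule R[i] A & StarAlgebra R A & isCStarNorm R A}.

Definition is_star_hom (R : realType) (A B : starAlgType R) (f : A -> B) :=
  [/\ linear f, {morph f : x y / x ** y} & {morph f : x / x^*s}].

(* A bijective *-homomorphism between C*-algebras is isometric, so no
   condition on norms is needed. *)
Definition star_isomorphic (R : realType) (A B : starAlgType R) :=
  exists f : A -> B, is_star_hom f /\ bijective f.

(* The matrix algebra M_n(A). This is a copy of 'M[A]_n because matrices over
   an arbitrary module carry no algebra structure in the library. *)
Definition matrix_alg (R : realType) (n : nat) (A : starAlgType R) : Type :=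
  'M[A]_n.

Section MatrixAlgebra.
Context (R : realType) (n : nat) (A : starAlgType R).
Local Notation M := (matrix_alg n A).

HB.instance Definition _ := GRing.Zmodule.on M.

Definition matrix_scale (c : R[i]) (a : M) : M :=
  \matrix_(i, j) (c *: (a : 'M[A]_n) i j).

Definition matrix_smul (a b : M) : M :=
  \matrix_(i, j) \sum_k (a : 'M[A]_n) i k ** (b : 'M[A]_n) k j.

Definition matrix_star (a : M) : M := \matrix_(i, j) ((a : 'M[A]_n) j i)^*s.

Lemma smul0l (x : A) : 0 ** x = 0.
Proof. by apply: (addrI (0 ** x)); rewrite -smulDl !addr0. Qed.

Lemma smul0r (x : A) : x ** 0 = 0.
Proof. by apply: (addrI (x ** 0)); rewrite -smulDr !addr0. Qed.

Lemma star0 : (0 : A)^*s = 0.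
Proof. by apply: (addrI (0 : A)^*s); rewrite -starD !addr0. Qed.

Lemma smul_suml (I : finType) (F : I -> A) x :
  (\sum_i F i) ** x = \sum_i F i ** x.
Proof.
by apply: (big_morph (fun y => y ** x)) => [? ?|]; rewrite ?smulDl ?smul0l.
Qed.

Lemma smul_sumr (I : finType) (F : I -> A) x :
  x ** (\sum_i F i) = \sum_i x ** F i.
Proof.
by apply: (big_morph (fun y => x ** y)) => [? ?|]; rewrite ?smulDr ?smul0r.
Qed.

Lemma star_sum (I : finType) (F : I -> A) :
  (\sum_i F i)^*s = \sum_i (F i)^*s.
Proof. by apply: (big_morph (fun y => y^*s)); [exact: starD|exact: star0]. Qed.

Fact matrix_scaleA c d a :
  matrix_scale c (matrix_scale d a) = matrix_scale (c * d) a.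
Proof. by apply/matrixP => i j; rewrite !mxE scalerA. Qed.

Fact matrix_scale1 : left_id 1 matrix_scale.
Proof. by move=> a; apply/matrixP => i j; rewrite !mxE scale1r. Qed.

Fact matrix_scaleDr : right_distributive matrix_scale +%R.
Proof. by move=> c a b; apply/matrixP => i j; rewrite !mxE scalerDr. Qed.

Fact matrix_scaleDl a : {morph matrix_scale^~ a : c d / c + d}.
Proof. by move=> c d; apply/matrixP => i j; rewrite !mxE scalerDl. Qed.

HB.instance Definition _ := GRing.Zmodule_isLmodule.Build R[i] M
  matrix_scaleA matrix_scale1 matrix_scaleDr matrix_scaleDl.

Fact matrix_smulA : associative matrix_smul.
Proof.
move=> a b c; apply/matrixP => i j; rewrite !mxE.
under eq_bigr do rewrite mxE smul_sumr.
under [RHS]eq_bigr do rewrite mxE smul_suml.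
rewrite exchange_big/=; apply: eq_bigr => k _; apply: eq_bigr => l _.
exact: smulA.
Qed.

Fact matrix_smulDl : left_distributive matrix_smul +%R.
Proof.
move=> a b c; apply/matrixP => i j; rewrite !mxE -big_split/=.
by apply: eq_bigr => k _; rewrite !mxE smulDl.
Qed.

Fact matrix_smulDr : right_distributive matrix_smul +%R.
Proof.
move=> a b c; apply/matrixP => i j; rewrite !mxE -big_split/=.
by apply: eq_bigr => k _; rewrite !mxE smulDr.
Qed.

Fact matrix_smulZl (c : R[i]) (a b : M) :
  matrix_smul (c *: a) b = c *: matrix_smul a b.
Proof.
apply/matrixP => i j; rewrite !mxE scaler_sumr.
by apply: eq_bigr => k _; rewrite !mxE smulZl.
Qed.

Fact matrix_smulZr (c : R[i]) (a b : M) :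
  matrix_smul a (c *: b) = c *: matrix_smul a b.
Proof.
apply/matrixP => i j; rewrite !mxE scaler_sumr.
by apply: eq_bigr => k _; rewrite !mxE smulZr.
Qed.

Fact matrix_starK : involutive matrix_star.
Proof. by move=> a; apply/matrixP => i j; rewrite !mxE starK. Qed.

Fact matrix_starD : {morph matrix_star : a b / a + b}.
Proof. by move=> a b; apply/matrixP => i j; rewrite !mxE starD. Qed.

Fact matrix_starZ (c : R[i]) (a : M) :
  matrix_star (c *: a) = Num.conj c *: matrix_star a.
Proof. by apply/matrixP => i j; rewrite !mxE starZ. Qed.

Fact matrix_starM (a b : M) :
  matrix_star (matrix_smul a b) = matrix_smul (matrix_star b) (matrix_star a).
Proof.
apply/matrixP => i j; rewrite !mxE star_sum.
by apply: eq_bigr => k _; rewrite !mxE starM.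
Qed.

HB.instance Definition _ := Lmodule_isStarAlgebra.Build R M
  matrix_smulA matrix_smulDl matrix_smulDr matrix_smulZl matrix_smulZr
  matrix_starK matrix_starD matrix_starZ matrix_starM.

End MatrixAlgebra.

Definition direct_sum (R : realType) (m : nat) (B : 'I_m -> starAlgType R) :
  Type := forall i, B i.

Section DirectSum.
Context (R : realType) (m : nat) (B : 'I_m -> starAlgType R).
Local Notation D := (direct_sum B).
Local Notation dfunext := functional_extensionality_dep.

HB.instance Definition _ := gen_eqMixin D.
HB.instance Definition _ := gen_choiceMixin D.

Definition direct_sum_zero : D := fun i => 0.
Definition direct_sum_opp (a : D) : D := fun i => - a i.
Definition direct_sum_add (a b : D) : D := fun i => a i + b i.
Definition direct_sum_scale (c : R[i]) (a : D) : D := fun i => c *: a i.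
Definition direct_sum_smul (a b : D) : D := fun i => a i ** b i.
Definition direct_sum_star (a : D) : D := fun i => (a i)^*s.

Fact direct_sum_addA : associative direct_sum_add.
Proof. by move=> a b c; apply: dfunext => i; exact: addrA. Qed.

Fact direct_sum_addC : commutative direct_sum_add.
Proof. by move=> a b; apply: dfunext => i; exact: addrC. Qed.

Fact direct_sum_add0 : left_id direct_sum_zero direct_sum_add.
Proof. by move=> a; apply: dfunext => i; exact: add0r. Qed.

Fact direct_sum_addN :
  left_inverse direct_sum_zero direct_sum_opp direct_sum_add.
Proof. by move=> a; apply: dfunext => i; exact: addNr. Qed.

HB.instance Definition _ := GRing.isZmodule.Build D
  direct_sum_addA direct_sum_addC direct_sum_add0 direct_sum_addN.

Fact direct_sum_scaleA c d a :
  direct_sum_scale c (direct_sum_scale d a) = direct_sum_scale (c * d) a.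
Proof. by apply: dfunext => i; exact: scalerA. Qed.

Fact direct_sum_scale1 : left_id 1 direct_sum_scale.
Proof. by move=> a; apply: dfunext => i; exact: scale1r. Qed.

Fact direct_sum_scaleDr : right_distributive direct_sum_scale +%R.
Proof. by move=> c a b; apply: dfunext => i; exact: scalerDr. Qed.

Fact direct_sum_scaleDl a : {morph direct_sum_scale^~ a : c d / c + d}.
Proof. by move=> c d; apply: dfunext => i; exact: scalerDl. Qed.

HB.instance Definition _ := GRing.Zmodule_isLmodule.Build R[i] D
  direct_sum_scaleA direct_sum_scale1 direct_sum_scaleDr direct_sum_scaleDl.

Fact direct_sum_smulA : associative direct_sum_smul.
Proof. by move=> a b c; apply: dfunext => i; exact: smulA. Qed.

Fact direct_sum_smulDl : left_distributive direct_sum_smul +%R.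
Proof. by move=> a b c; apply: dfunext => i; exact: smulDl. Qed.

Fact direct_sum_smulDr : right_distributive direct_sum_smul +%R.
Proof. by move=> a b c; apply: dfunext => i; exact: smulDr. Qed.

Fact direct_sum_smulZl (c : R[i]) (a b : D) :
  direct_sum_smul (c *: a) b = c *: direct_sum_smul a b.
Proof. by apply: dfunext => i; exact: smulZl. Qed.

Fact direct_sum_smulZr (c : R[i]) (a b : D) :
  direct_sum_smul a (c *: b) = c *: direct_sum_smul a b.
Proof. by apply: dfunext => i; exact: smulZr. Qed.

Fact direct_sum_starK : involutive direct_sum_star.
Proof. by move=> a; apply: dfunext => i; exact: starK. Qed.

Fact direct_sum_starD : {morph direct_sum_star : a b / a + b}.
Proof. by move=> a b; apply: dfunext => i; exact: starD. Qed.

Fact direct_sum_starZ (c : R[i]) (a : D) :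
  direct_sum_star (c *: a) = Num.conj c *: direct_sum_star a.
Proof. by apply: dfunext => i; exact: starZ. Qed.

Fact direct_sum_starM (a b : D) : direct_sum_star (direct_sum_smul a b) =
  direct_sum_smul (direct_sum_star b) (direct_sum_star a).
Proof. by apply: dfunext => i; exact: starM. Qed.

HB.instance Definition _ := Lmodule_isStarAlgebra.Build R D
  direct_sum_smulA direct_sum_smulDl direct_sum_smulDr
  direct_sum_smulZl direct_sum_smulZr
  direct_sum_starK direct_sum_starD direct_sum_starZ direct_sum_starM.

End DirectSum.

(* C_0(Y): continuous functions vanishing at infinity. The target is R[i]^o
   because the topology of R[i] is attached to its regular module. *)
Definition vanishing_at_infinity (R : realType) (Y : topologicalType)
    (f : Y -> R[i]^o) :=
  continuous f /\
  forall e : R[i], 0 < e -> compact [set y | e <= `|f y|].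

Section C0.
Context (R : realType) (Y : topologicalType).
Implicit Types f g : Y -> R[i]^o.

Lemma closed_norm_ge f (e : R[i]) : continuous f -> 0 < e ->
  closed [set y | e <= `|f y|].
Proof.
move=> cf e0.
suff -> : [set y | e <= `|f y|] = ~` (f @^-1` (ball (0 : R[i]^o) e)).
  apply: open_closedC; apply: open_comp; first by move=> y _; exact: cf.
  exact: ball_open.
apply/seteqP; split => y /=; rewrite -ball_normE/= sub0r normrN.
  by move=> h1 h2; have := le_lt_trans h1 h2; rewrite ltxx.
by move/negP; rewrite -real_leNgt ?normr_real// ger0_real// ltW.
Qed.

Lemma vanishing0 : vanishing_at_infinity (0 : Y -> R[i]^o).
Proof.
split; first by move=> y; exact: cst_continuous.
move=> e e0; rewrite (_ : [set _ | _] = set0); first exact: compact0.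
apply/seteqP; split => // y /=; rewrite normr0 => /(lt_le_trans e0).
by rewrite ltxx.
Qed.

Lemma vanishingD f g : vanishing_at_infinity f -> vanishing_at_infinity g ->
  vanishing_at_infinity (f + g).
Proof.
move=> [cf vf] [cg vg]; have cfg : continuous (f + g).
  by move=> y; apply: cvgD; [exact: cf|exact: cg].
split => // e e0; have e20 : 0 < e / 2 by rewrite divr_gt0.
apply: (subclosed_compact (closed_norm_ge cfg e0)
  (compactU (vf _ e20) (vg _ e20))) => y /= h.
have [?|] := real_leP (ger0_real (ltW e20)) (normr_real (f y)); first by left.
move=> fy; right; rewrite real_leNgt ?normr_real ?ger0_real// ?ltW//.
apply/negP => gy; have := le_lt_trans (ler_normD _ _) (ltrD fy gy).
by rewrite -splitr => /(le_lt_trans h); rewrite ltxx.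
Qed.

Lemma vanishingM f g : vanishing_at_infinity f -> vanishing_at_infinity g ->
  vanishing_at_infinity (fun y => f y * g y).
Proof.
move=> [cf vf] [cg vg]; have cfg : continuous (fun y => f y * g y : R[i]^o).
  by move=> y; apply: cvgM; [exact: cf|exact: cg].
split => // e e0.
apply: (subclosed_compact (closed_norm_ge cfg e0)
  (compactU (vf _ ltr01) (vg _ e0))) => y /= h.
have [?|] := real_leP (@real1 R[i]) (normr_real (f y)); first by left.
move=> fy; right; apply: le_trans h _.
by rewrite normrM ler_piMl// ltW.
Qed.

Lemma vanishingZ (c : R[i]) f : vanishing_at_infinity f ->
  vanishing_at_infinity (c *: f).
Proof.
move=> [cf vf]; have cfg : continuous (c *: f).
  by move=> y; apply: cvgZr; exact: cf.
have [->|c0] := eqVneq c 0; first by rewrite scale0r; exact: vanishing0.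
split => // e e0; have ce : 0 < e / `|c| by rewrite divr_gt0 ?normr_gt0.
apply: (subclosed_compact (closed_norm_ge cfg e0) (vf _ ce)) => y /= h.
by rewrite ler_pdivrMr ?normr_gt0// mulrC -normrM.
Qed.

Lemma vanishing_conj f : vanishing_at_infinity f ->
  vanishing_at_infinity (fun y => Num.conj (f y)).
Proof.
move=> [cf vf]; split; last first.
  move=> e e0; rewrite (_ : [set _ | _] = [set y | e <= `|f y|]).
    exact: vf.
  by apply/seteqP; split => y /=; rewrite norm_conjC.
move=> y; apply/cvgrPdist_lt => e e0.
have /cvgrPdist_lt/(_ e e0) := cf y; apply: filterS => z.
by rewrite -rmorphB norm_conjC.
Qed.

Definition C0_pred : pred (Y -> R[i]^o) :=
  fun f => `[< vanishing_at_infinity f >].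

Fact C0_pred_closed : subsemimod_closed C0_pred.
Proof.
split; [split|].
- exact/asboolP/vanishing0.
- by move=> f g /asboolP ? /asboolP ?; exact/asboolP/vanishingD.
- by move=> c f /asboolP ?; exact/asboolP/vanishingZ.
Qed.

Definition C0 : Type := {f : Y -> R[i]^o | C0_pred f}.

HB.instance Definition _ := [isSub of C0 for @sval _ C0_pred].
HB.instance Definition _ := [Choice of C0 by <:].
HB.instance Definition _ :=
  GRing.SubChoice_isSubLmodule.Build R[i] (Y -> R[i]^o) C0_pred C0
    C0_pred_closed.

Definition C0_smul (f g : C0) : C0 :=
  exist _ (fun y => val f y * val g y)
    (asboolT (vanishingM (asboolW (valP f)) (asboolW (valP g)))).

Definition C0_star (f : C0) : C0 :=
  exist _ (fun y => Num.conj (val f y))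
    (asboolT (vanishing_conj (asboolW (valP f)))).

Fact C0_smulA : associative C0_smul.
Proof. by move=> f g h; apply/val_inj/funext => y; exact: mulrA. Qed.

Fact C0_smulDl : left_distributive C0_smul +%R.
Proof. by move=> f g h; apply/val_inj/funext => y; exact: mulrDl. Qed.

Fact C0_smulDr : right_distributive C0_smul +%R.
Proof. by move=> f g h; apply/val_inj/funext => y; exact: mulrDr. Qed.

Fact C0_smulZl (c : R[i]) (f g : C0) : C0_smul (c *: f) g = c *: C0_smul f g.
Proof. by apply/val_inj/funext => y; symmetry; exact: mulrA. Qed.

Fact C0_smulZr (c : R[i]) (f g : C0) : C0_smul f (c *: g) = c *: C0_smul f g.
Proof. by apply/val_inj/funext => y; exact: mulrCA. Qed.

Fact C0_starK : involutive C0_star.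
Proof. by move=> f; apply/val_inj/funext => y; exact: conjCK. Qed.

Fact C0_starD : {morph C0_star : f g / f + g}.
Proof. by move=> f g; apply/val_inj/funext => y; exact: rmorphD. Qed.

Fact C0_starZ (c : R[i]) (f : C0) : C0_star (c *: f) = Num.conj c *: C0_star f.
Proof. by apply/val_inj/funext => y; exact: rmorphM. Qed.

Fact C0_starM (f g : C0) :
  C0_star (C0_smul f g) = C0_smul (C0_star g) (C0_star f).
Proof.
by apply/val_inj/funext => y; rewrite /= mulrC; exact: rmorphM.
Qed.

HB.instance Definition _ := Lmodule_isStarAlgebra.Build R C0
  C0_smulA C0_smulDl C0_smulDr C0_smulZl C0_smulZr
  C0_starK C0_starD C0_starZ C0_starM.

End C0.

Definition closed_ideal (R : realType) (A : cstarAlgType R) (I : set A) :=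
  [/\ closed I, I 0, forall x y, I x -> I y -> I (x + y),
      forall (c : R[i]) x, I x -> I (c *: x) &
      forall a x, I x -> I (a ** x) /\ I (x ** a)].

Definition noetherian (R : realType) (A : cstarAlgType R) :=
  forall I : nat -> set A, (forall n, closed_ideal (I n)) ->
    (forall n, I n `<=` I n.+1) ->
    exists n, forall i, (n <= i)%N -> I i = I n.

Definition separable_space (T : topologicalType) :=
  exists D : set T, countable D /\ dense D.

Definition cstar_positive (R : realType) (A : cstarAlgType R) (x : A) :=
  exists a : A, x = a^*s ** a.

Definition is_character (R : realType) (A : cstarAlgType R)
    (chi : A -> R[i]^o) :=
  [/\ linear chi, forall x y, chi (x ** y) = chi x * chi y &
      exists x, chi x != 0].

Definition purely_infinite (R : realType) (A : cstarAlgType R) :=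
  ~ (exists chi : A -> R[i]^o, is_character chi) /\
  forall x y : A, cstar_positive x -> cstar_positive y ->
    smallest (@closed_ideal R A) [set x] y ->
    exists a : nat -> A, (fun n => a n ** x ** (a n)^*s) @ \oo --> y.

Section Projections.
Context (R : realType) (A : starAlgType R).
Implicit Types p q : A.

Definition is_projection p := p ** p = p /\ p^*s = p.

Definition mvn_equivalent p q := exists v : A, v^*s ** v = p /\ v ** v^*s = q.

Definition subprojection q p := p ** q = q.

Definition infinite_projection p :=
  is_projection p /\
  exists q, [/\ is_projection q, subprojection q p, q <> p
              & mvn_equivalent p q].

End Projections.

Definition stably_finite (R : realType) (A : cstarAlgType R) :=
  forall n, ~ exists p : matrix_alg n A, infinite_projection p.

(* (A, mu) is the inductive limit of B 0 -> B 1 -> ... in the category of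
   C*-algebras and *-homomorphisms: the universal cocone. *)
Definition is_inductive_limit (R : realType) (B : nat -> cstarAlgType R)
    (phi : forall n, B n -> B n.+1)
    (A : cstarAlgType R) (mu : forall n, B n -> A) :=
  [/\ forall n, is_star_hom (mu n),
      forall n x, mu n.+1 (phi n x) = mu n x &
      forall (C : cstarAlgType R) (lambda : forall n, B n -> C),
        (forall n, is_star_hom (lambda n)) ->
        (forall n x, lambda n.+1 (phi n x) = lambda n x) ->
        exists! f : A -> C,
          is_star_hom f /\ forall n x, f (mu n x) = lambda n x].

(* The complement of x0 carries the subspace topology. *)
Definition punctured (X : topologicalType) (x0 : X) : topologicalType :=
  [the topologicalType of set_type (~` [set x0])].

(* Finite direct sums of algebras M_k(C_0(X \ {x0})). A metrizable space is
   given with a metric, of which only the topology is used. *)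
Definition is_AH0_block (R : realType) (B : cstarAlgType R) :=
  exists (m : nat) (k : 'I_m -> nat) (X : 'I_m -> metricType R)
         (x0 : forall i, X i),
    [/\ forall i, (0 < k i)%N,
        forall i, compact [set: X i],
        forall i, connected [set: X i] &
        star_isomorphic B
          (direct_sum (fun i => matrix_alg (k i) (C0 R (punctured (x0 i)))))].

Definition is_AH0 (R : realType) (A : cstarAlgType R) :=
  exists (B : nat -> cstarAlgType R) (phi : forall n, B n -> B n.+1)
         (mu : forall n, B n -> A),
    [/\ forall n, is_AH0_block (B n), forall n, is_star_hom (phi n) &
        is_inductive_limit phi mu].

(* The zero algebra satisfies every other condition considered here. *)
Definition nonzero_alg (R : realType) (A : cstarAlgType R) :=
  exists a : A, a != 0.

(* Main.v *)
Require Import Defs.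
From HB Require Import structures.
From mathcomp Require Import all_boot all_order all_algebra.
From mathcomp Require Import all_classical all_reals all_analysis.
From mathcomp Require Import complex ring lra.

Set Implicit Arguments.
Unset Strict Implicit.
Unset Printing Implicit Defensive.

Import Order.TTheory GRing.Theory Num.Theory.
Import numFieldNormedType.Exports.

Local Open Scope classical_set_scope.
Local Open Scope ring_scope.
Local Open Scope complex_scope.

(** The two statements have the same core: a nonzero noetherian purely infinite
algebra [A] contains an infinite projection.  That contradicts stable
finiteness at once, and an AH_0-algebra has no nonzero idempotent at all.

Everything is done inside [A], without unitization: a factor [1 - x] only
occurs in products that have been multiplied out.  The order on self-adjoint
elements is replaced by one inequality, [|x|^2 <= |x^2 + y^2|] for commuting
self-adjoint [x] and [y] ([nrm_sqr_le_add]), and the continuous functional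
calculus by the solution [w] of [(1 - w)^2 = 1 - u] ([half_root]).  From these
come cut-off functions [p_0], [p_1], ... of a self-adjoint element, each a unit
for the one before ([cutoff_functions]).

Suppose that the positive element [e e] generates an ideal that contains
[f f], where [f] is 1 both where [e] lives and on some [c] far from [e].  Pure
infiniteness compresses [f f] into the corner of [e].  This gives an isometry
[v] of the algebra with a unit adjoined, which is not onto because its range
misses [c].  The defect [p = 1 - v v*] and [v p v*] are disjoint equivalent
projections, and their sum, which lies in the ideal of [p], is equivalent to a
part of [p]: it is infinite ([compression_infinite],
[disjoint_copy_infinite]).

The ideals generated by the squares of cut-off functions increase, so the
chain condition makes such [e], [c], [f] available, unless the cut-offs stop
at a projection [e0].  Below [e0], maximize the ideal of [e e] among elements
[e] that some nonzero [c] avoids.  If [e0] is in this ideal, it plays the role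
of [f].  Otherwise maximality leaves room for a projection [q] only such that
nonzero self-adjoint elements of [q A q] are not zero divisors; then [q A q]
consists of scalars ([corner_real]).  Such a [q] has a disjoint copy, or else
it is central and compression by it is a character, which is excluded
([minimal_infinite], [projection_infinite]).

For the second statement, an idempotent matrix of functions on a connected
space that vanish at a point is 0 ([block_no_idempotent]).  A concrete model of
the inductive limit, coherent families modulo null families, then has no
idempotents either, since an almost idempotent element is near an idempotent.
The universal property embeds [A] into this model
([inductive_limit_no_idempotent]). *)

(** * Identities in algebras without unit *)

Section Star.
Context (R : realType) (A : starAlgType R).
Implicit Types x y z : A.

Lemma starN x : (- x)^*s = - x^*s.
Proof. by apply: (addIr x^*s); rewrite -starD !addNr star0. Qed.

Lemma starB x y : (x - y)^*s = x^*s - y^*s.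
Proof. by rewrite starD starN. Qed.

Lemma starZr (c : R) x : (c%:C *: x)^*s = c%:C *: x^*s.
Proof. by rewrite starZ; congr (_ *: _); apply/CrealP; rewrite complex_real. Qed.

Lemma smulNl x y : (- x) ** y = - (x ** y).
Proof. by apply: (addIr (x ** y)); rewrite -smulDl !addNr smul0l. Qed.

Lemma smulNr x y : x ** (- y) = - (x ** y).
Proof. by apply: (addIr (x ** y)); rewrite -smulDr !addNr smul0r. Qed.

Lemma smulBl x y z : (x - y) ** z = x ** z - y ** z.
Proof. by rewrite smulDl smulNl. Qed.

Lemma smulBr x y z : z ** (x - y) = z ** x - z ** y.
Proof. by rewrite smulDr smulNr. Qed.

End Star.

(** Formal linear combinations of non-empty words: an equation that holds in
every associative algebra holds because its two sides have the same normal
form.  A word is a pair of its first letter and the rest, since there is no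
unit to interpret the empty word. *)
Module NC.

Definition word := (nat * seq nat)%type.

Inductive expr (K : Type) :=
| Var of nat
| Zero
| Add of expr K & expr K
| Opp of expr K
| Scale of K & expr K
| Mul of expr K & expr K.
Arguments Var {K}.
Arguments Zero {K}.

Fixpoint eqn (m n : nat) : bool :=
  match m, n with
  | 0, 0 => true | S m, S n => eqn m n | _, _ => false
  end.

Fixpoint eqs (s t : seq nat) : bool :=
  match s, t with
  | [::], [::] => true
  | m :: s, n :: t => if eqn m n then eqs s t else false
  | _, _ => false
  end.

Definition eqw (u v : word) : bool :=
  if eqn u.1 v.1 then eqs u.2 v.2 else false.

Lemma eqnP m n : eqn m n -> m = n.
Proof. by elim: m n => [|m IH] [|n]//= /IH ->. Qed.

Lemma eqsP s t : eqs s t -> s = t.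
Proof.
elim: s t => [|m s IH] [|n t]//=.
by case E: (eqn m n) => // /IH ->; rewrite (eqnP E).
Qed.

Lemma eqwP u v : eqw u v -> u = v.
Proof.
case: u v => [m s] [n t]; rewrite /eqw/=.
by case E: (eqn m n) => // /eqsP ->; rewrite (eqnP E).
Qed.

Fixpoint appw (s t : seq nat) : seq nat :=
  match s with [::] => t | m :: s => m :: appw s t end.

Definition mulw (u v : word) : word := (u.1, appw u.2 (v.1 :: v.2)).

Section Normal.
Context (K : nzRingType).
Definition lcomb := seq (word * K).

Fixpoint insert (w : word) (c : K) (l : lcomb) : lcomb :=
  match l with
  | [::] => [:: (w, c)]
  | (v, d) :: l => if eqw w v then (v, c + d) :: l else (v, d) :: insert w c l
  end.

Fixpoint add (l m : lcomb) : lcomb :=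
  match l with [::] => m | (w, c) :: l => insert w c (add l m) end.

Fixpoint scale (c : K) (l : lcomb) : lcomb :=
  match l with [::] => [::] | (w, d) :: l => (w, c * d) :: scale c l end.

Fixpoint mulword (u : word) (c : K) (l : lcomb) : lcomb :=
  match l with
  | [::] => [::] | (w, d) :: l => insert (mulw u w) (c * d) (mulword u c l)
  end.

Fixpoint mul (l m : lcomb) : lcomb :=
  match l with [::] => [::] | (w, c) :: l => add (mulword w c m) (mul l m) end.

Fixpoint norm (e : expr K) : lcomb :=
  match e with
  | Var n => [:: ((n, [::]), 1)]
  | Zero => [::]
  | Add e f => add (norm e) (norm f)
  | Opp e => scale (-1) (norm e)
  | Scale c e => scale c (norm e)
  | Mul e f => mul (norm e) (norm f)
  end.

Fixpoint vanish (l : lcomb) : Prop :=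
  match l with [::] => True | (_, c) :: l => c = 0 /\ vanish l end.

End Normal.

Section Interp.
Context (R : realType) (A : starAlgType R) (env : seq A).

Definition letter n : A := nth 0 env n.

Fixpoint iword (a : A) (s : seq nat) : A :=
  match s with [::] => a | n :: s => iword (a ** letter n) s end.

Definition ival (w : word) : A := iword (letter w.1) w.2.

Fixpoint ilc (l : lcomb R[i]) : A :=
  match l with [::] => 0 | (w, c) :: l => c *: ival w + ilc l end.

Fixpoint interp (e : expr R[i]) : A :=
  match e with
  | Var n => letter n
  | Zero => 0
  | Add e f => interp e + interp f
  | Opp e => - interp e
  | Scale c e => c *: interp e
  | Mul e f => interp e ** interp f
  end.

Lemma iword_mul a b s : a ** iword b s = iword (a ** b) s.
Proof. by elim: s a b => [//|n s IH] a b /=; rewrite IH smulA. Qed.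

Lemma ival_mul u v : ival (mulw u v) = ival u ** ival v.
Proof.
case: u v => [m s] [n t]; rewrite /ival/= iword_mul.
by elim: s (letter m) => [//|k s IH] a /=; exact: IH.
Qed.

Lemma ilc_insert w c l : ilc (insert w c l) = c *: ival w + ilc l.
Proof.
elim: l => [//|[v d] l IH] /=; case: ifP => [/eqwP ->|_] /=.
  by rewrite scalerDl addrA.
by rewrite IH addrCA.
Qed.

Lemma ilc_add l m : ilc (add l m) = ilc l + ilc m.
Proof.
by elim: l => [|[w c] l IH] /=; rewrite ?add0r// ilc_insert IH addrA.
Qed.

Lemma ilc_scale c l : ilc (scale c l) = c *: ilc l.
Proof.
by elim: l => [|[w d] l IH] /=; rewrite ?scaler0// IH scalerDr scalerA.
Qed.

Lemma ilc_mulword w c l : ilc (mulword w c l) = (c *: ival w) ** ilc l.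
Proof.
elim: l => [|[v d] l IH] /=; first by rewrite smul0r.
rewrite ilc_insert IH smulDr ival_mul; congr (_ + _).
by rewrite smulZr smulZl scalerA mulrC.
Qed.

Lemma ilc_mul l m : ilc (mul l m) = ilc l ** ilc m.
Proof.
elim: l => [|[w c] l IH] /=; first by rewrite smul0l.
by rewrite ilc_add ilc_mulword IH smulDl.
Qed.

Lemma ilc_norm e : ilc (norm e) = interp e.
Proof.
elim: e => [n||e IHe f IHf|e IH|c e IH|e IHe f IHf] //=.
- by rewrite scale1r addr0.
- by rewrite ilc_add IHe IHf.
- by rewrite ilc_scale IH scaleN1r.
- by rewrite ilc_scale IH.
- by rewrite ilc_mul IHe IHf.
Qed.

Lemma vanishP l : vanish l -> ilc l = 0.
Proof. by elim: l => [//|[w c] l IH] /= [-> /IH ->]; rewrite scale0r addr0. Qed.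

Lemma interp_eq e f : vanish (norm (Add e (Opp f))) -> interp e = interp f.
Proof. by move/vanishP; rewrite ilc_norm/= => /subr0_eq. Qed.

End Interp.

Ltac index a l :=
  lazymatch l with
  | a :: _ => constr:(0%N)
  | _ :: ?l => let n := index a l in constr:(S n)
  end.

Ltac push a l :=
  let rec go m :=
    lazymatch m with
    | a :: _ => l
    | _ :: ?m => go m
    | _ => constr:(a :: l)
    end in go l.

Ltac atoms e l :=
  lazymatch e with
  | GRing.zero => l
  | GRing.add ?x ?y => let l := atoms x l in atoms y l
  | GRing.opp ?x => atoms x l
  | GRing.scale ?c ?x => atoms x l
  | smul ?x ?y => let l := atoms x l in atoms y l
  | _ => push e l
  end.

Ltac quote K l e :=
  lazymatch e with
  | GRing.zero => constr:(@Zero K)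
  | GRing.add ?x ?y =>
    let x := quote K l x in let y := quote K l y in constr:(@Add K x y)
  | GRing.opp ?x => let x := quote K l x in constr:(@Opp K x)
  | GRing.scale ?c ?x => let x := quote K l x in constr:(@Scale K c x)
  | smul ?x ?y =>
    let x := quote K l x in let y := quote K l y in constr:(@Mul K x y)
  | _ => let n := index e l in constr:(@Var K n)
  end.

End NC.

Ltac nc :=
  lazymatch goal with
  | R : realType |- @eq ?T ?x ?y =>
    let l := NC.atoms x (@nil T) in
    let l := NC.atoms y l in
    let e := NC.quote (R[i]) l x in
    let f := NC.quote (R[i]) l y in
    refine (@NC.interp_eq R _ l e f _);
    cbv [NC.norm NC.add NC.insert NC.scale NC.mul NC.mulword NC.mulw
         NC.appw NC.eqw NC.eqs NC.eqn NC.vanish fst snd];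
    repeat split; try by [ring | field]
  end.

(** * Norms *)

Section Norm.
Context (R : realType).

Lemma gt0_complex (e : R[i]) : 0 < e -> exists2 r : R, 0 < r & e = r%:C.
Proof.
move=> e0; have eE : e = (complex.Re e)%:C by rewrite RRe_real// ger0_real// ltW.
by exists (complex.Re e) => //; rewrite -ltcR -eE.
Qed.

Lemma complex_gt0 (r : R) : 0 < r -> 0 < r%:C.
Proof. by rewrite -[0 : R[i]]/(0%:C) ltcR. Qed.

Definition nrm (V : normedModType R[i]) (x : V) : R := complex.Re `|x|.

Section Module.
Context (V : normedModType R[i]).
Implicit Types x y : V.

Lemma nrmE x : `|x| = (nrm x)%:C.
Proof. by rewrite /nrm RRe_real// ger0_real. Qed.

Lemma nrm_ge0 x : 0 <= nrm x.
Proof. by have := normr_ge0 x; rewrite nrmE lecR. Qed.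

Lemma nrm0 : nrm (0 : V) = 0.
Proof. by rewrite /nrm normr0. Qed.

Lemma nrm_eq0 x : nrm x = 0 -> x = 0.
Proof. by move=> x0; apply/normr0_eq0; rewrite nrmE x0. Qed.

Lemma nrm_gt0 x : x != 0 -> 0 < nrm x.
Proof.
by move=> x0; rewrite lt_def nrm_ge0 andbT; apply: contra_neq x0 => /nrm_eq0.
Qed.

Lemma nrmN x : nrm (- x) = nrm x.
Proof. by rewrite /nrm normrN. Qed.

Lemma nrmB x y : nrm (x - y) = nrm (y - x).
Proof. by rewrite -nrmN opprB. Qed.

Lemma nrmD x y : nrm (x + y) <= nrm x + nrm y.
Proof. by have := ler_normD x y; rewrite !nrmE -rmorphD lecR. Qed.

Lemma nrmD3 x y z : nrm (x - z) <= nrm (x - y) + nrm (y - z).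
Proof. by apply: le_trans (nrmD _ _); rewrite addrA subrK. Qed.

Lemma nrmZ (c : R) x : nrm (c%:C *: x) = `|c| * nrm x.
Proof.
apply: (@complexI R); rewrite -nrmE normrZ nrmE rmorphM/=; congr (_ * _).
by rewrite normc_def/= expr0n addr0 sqrtr_sqr.
Qed.

Lemma nrmZc (c : R[i]) x : (nrm (c *: x))%:C = `|c| * (nrm x)%:C.
Proof. by rewrite -!nrmE normrZ. Qed.

End Module.

Section CStar.
Context (A : cstarAlgType R).
Implicit Types x y : A.

Lemma nrmM x y : nrm (x ** y) <= nrm x * nrm y.
Proof. by have := normr_smul_le x y; rewrite !nrmE -rmorphM lecR. Qed.

Lemma nrmSM x : nrm (x^*s ** x) = nrm x ^+ 2.
Proof.
by have := normr_star_smul x; rewrite !nrmE -rmorphXn/= => /complexI.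
Qed.

Lemma nrm_star x : nrm x^*s = nrm x.
Proof.
suff le y : nrm y <= nrm y^*s.
  by apply/le_anti; rewrite le !andbT -{2}(starK x) le.
have [->|y0] := eqVneq y 0; first by rewrite star0.
rewrite -(ler_pM2r (nrm_gt0 y0)) -expr2 -nrmSM; exact: nrmM.
Qed.

Lemma starM_eq0 x : x^*s ** x = 0 -> x = 0.
Proof.
by move=> x0; apply: nrm_eq0; apply/eqP; rewrite -sqrf_eq0 -nrmSM x0 nrm0.
Qed.

End CStar.
End Norm.

(** * Limits and closed subalgebras *)

Section Limits.
Context (R : realType).

Lemma expr_small (r e : R) : 0 <= r -> r < 1 -> 0 < e -> exists k, r ^+ k < e.
Proof.
move=> r0 r1 e0.
have /cvgrPdist_lt/(_ e e0)[N _ /(_ N (leqnn N))] :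
  (GRing.exp r : nat -> R) @ \oo --> 0 by apply: cvg_expr; rewrite ger0_norm.
by rewrite /= sub0r normrN ger0_norm ?exprn_ge0// => rN; exists N.
Qed.

Lemma half_expr_small (e : R) : 0 < e -> exists k, (2^-1 : R) ^+ k < e.
Proof. by apply: expr_small; lra. Qed.

Section Module.
Context (V : normedModType R[i]).
Implicit Types (x y : V) (S : set V) (u : nat -> V).

Definition lim_to u x :=
  forall e : R, 0 < e -> exists N, forall n, (N <= n)%N -> nrm (u n - x) < e.

Definition lim_closed S :=
  forall x, (forall e : R, 0 < e -> exists2 y, S y & nrm (x - y) < e) -> S x.

Lemma lim_closed_lim S u x :
  lim_closed S -> (forall n, S (u n)) -> lim_to u x -> S x.
Proof.
move=> cS Su ux; apply: cS => e /ux[N uN]; exists (u N) => //.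
by rewrite nrmB; exact: uN.
Qed.

Lemma nrm_small_eq0 x : (forall e : R, 0 < e -> nrm x <= e) -> x = 0.
Proof.
move=> xe; apply: nrm_eq0; apply/le_anti; rewrite nrm_ge0 andbT.
by apply/ler_addgt0Pr => e e0; rewrite add0r; exact: xe.
Qed.

Lemma closed_lim_closed S : closed S -> lim_closed S.
Proof.
move=> cS x xS; apply: cS => B /nbhs_ballP[_ /= /gt0_complex[e e0 ->] eB].
have [y Sy xy] := xS e e0; exists y; split=> //; apply: eB.
by rewrite -ball_normE/= nrmE ltcR.
Qed.

Lemma cvg_lim_to u x : u @ \oo --> x -> lim_to u x.
Proof.
move=> /cvgrPdist_lt ux e e0.
have /ux[N _ uN] := complex_gt0 e0.
by exists N => n /uN/=; rewrite nrmE ltcR nrmB.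
Qed.

Lemma lim_to_nrm_le u x (r : R) :
  (forall n, nrm (u n) <= r) -> lim_to u x -> nrm x <= r.
Proof.
move=> ur ux; apply/ler_addgt0Pr => e /ux[N uN].
rewrite -(subrK (u N) x) (le_trans (nrmD _ _))// addrC lerD// ltW// nrmB.
exact: uN.
Qed.

Lemma lim_to_fixpoint (F : V -> V) (K : R) u x : 0 <= K ->
  (forall n, u n.+1 = F (u n)) ->
  (forall n, nrm (F x - F (u n)) <= K * nrm (x - u n)) ->
  lim_to u x -> F x = x.
Proof.
move=> K0 uF FK ux; apply/subr0_eq/nrm_small_eq0 => e e0.
have K1 : 0 < K + 1 by rewrite ltr_wpDl.
have /ux[N uN] : 0 < e / (K + 1) by rewrite divr_gt0.
rewrite (le_trans (nrmD3 _ (u N.+1) _))//.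
have -> : e = K * (e / (K + 1)) + e / (K + 1) by field; rewrite gt_eqF.
apply: lerD; last by apply: ltW; apply: uN.
rewrite uF (le_trans (FK _))// ler_wpM2l// ltW// nrmB; exact: uN.
Qed.

End Module.

Lemma cauchy_lim (V : completeNormedModType R[i]) (u : nat -> V) :
  (forall e : R, 0 < e -> exists N, forall n, (N <= n)%N -> nrm (u n - u N) < e) ->
  exists x, lim_to u x.
Proof.
move=> uc; suff /cauchy_cvg : cauchy (u @ \oo).
  by move=> /cvg_ex[x ux]; exists x; apply: cvg_lim_to; exact: ux.
apply/cauchy_exP => _ /gt0_complex[e /uc[N uN] ->].
by exists (u N), N => // n Nn; rewrite /= -ball_normE/= nrmE ltcR nrmB uN.
Qed.

(** Steps bounded by the increments of a bounded real sequence add up to a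
finite length. *)
Lemma telescope_lim (V : completeNormedModType R[i]) (u : nat -> V)
    (c : nat -> R) (M : R) :
  (forall n, nrm (u n.+1 - u n) <= c n.+1 - c n) -> (forall n, c n <= M) ->
  exists x, lim_to u x.
Proof.
move=> uc cM; apply: cauchy_lim => e e0.
have uN n k : nrm (u (n + k)%N - u n) <= c (n + k)%N - c n.
  elim: k => [|k IH]; first by rewrite addn0 !subrr nrm0.
  rewrite addnS (le_trans (nrmD3 _ (u (n + k)%N) _))//.
  by have := lerD (uc (n + k)%N) IH; rewrite addrA subrK.
have supc : has_sup (range c) by split; [exists (c 0%N), 0%N|exists M => _ [n _ <-]].
have [_ [N _ <-] cN] := sup_adherent e0 supc.
exists N => n Nn; rewrite -(subnKC Nn) (le_lt_trans (uN _ _))// ltrBlDr.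
rewrite (@le_lt_trans _ _ (sup (range c)))// -?ltrBlDl//.
by apply: ub_le_sup => //; case: supc.
Qed.

End Limits.

Section Subalgebras.
Context (R : realType) (A : cstarAlgType R).
Implicit Types (x y z : A) (V : set A).

Definition closed_subalgebra V :=
  [/\ lim_closed V, forall x y, V x -> V y -> V (x + y),
      forall (c : R[i]) x, V x -> V (c *: x) &
      forall x y, V x -> V y -> V (x ** y)].

Section Closure.
Context (V : set A) (sV : closed_subalgebra V).

Lemma csa_lim : lim_closed V. Proof. by case: sV. Qed.

Lemma csaD x y : V x -> V y -> V (x + y). Proof. by case: sV => _ + _ _; apply. Qed.

Lemma csaZ (c : R[i]) x : V x -> V (c *: x).
Proof. by case: sV => _ _ + _; apply. Qed.

Lemma csaM x y : V x -> V y -> V (x ** y). Proof. by case: sV => _ _ _; apply. Qed.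

Lemma csaN x : V x -> V (- x). Proof. by rewrite -scaleN1r; exact: csaZ. Qed.

Lemma csaB x y : V x -> V y -> V (x - y).
Proof. by move=> Vx /csaN; exact: csaD. Qed.

End Closure.

(** Apart from ideals, the closed subalgebras below are solution sets of linear
equations; this gives their closedness. *)
Lemma lim_closed_eq (F G : A -> A) (K : R) : 0 <= K ->
  (forall x y, nrm ((F x - G x) - (F y - G y)) <= K * nrm (x - y)) ->
  lim_closed [set x | F x = G x].
Proof.
move=> K0 FG x xV /=; apply/subr0_eq/nrm_small_eq0 => e e0.
have K1 : 0 < K + 1 by rewrite ltr_wpDl.
have /xV[y /= Fy xy] : 0 < e / (K + 1) by rewrite divr_gt0.
have := FG x y; rewrite Fy subrr subr0 => /le_trans -> //.
rewrite (@le_trans _ _ (K * (e / (K + 1))))//.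
  by rewrite ler_wpM2l// ltW.
rewrite mulrCA ger_pMr// ler_pdivrMr// mul1r; lra.
Qed.

Lemma annihilator_subalgebra z : closed_subalgebra [set x | z ** x = 0].
Proof.
split.
- apply: (@lim_closed_eq _ _ (nrm z)); first exact: nrm_ge0.
  by move=> x y; rewrite [X in nrm X](_ : _ = z ** (x - y)); [exact: nrmM|nc].
- by move=> x y /= zx zy; rewrite smulDr zx zy addr0.
- by move=> c x /= zx; rewrite smulZr zx scaler0.
- by move=> x y /= zx zy; rewrite smulA zx smul0l.
Qed.

Lemma fixer_subalgebra z : closed_subalgebra [set x | z ** x = x].
Proof.
split.
- apply: (@lim_closed_eq _ _ (nrm z + 1)); first by rewrite addr_ge0// nrm_ge0.
  move=> x y; rewrite [X in nrm X](_ : _ = z ** (x - y) - (x - y)); last by nc.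
  by rewrite mulrDl mul1r (le_trans (nrmD _ _))// nrmN lerD ?nrmM.
- by move=> x y /= zx zy; rewrite smulDr zx zy.
- by move=> c x /= zx; rewrite smulZr zx.
- by move=> x y /= zx zy; rewrite smulA zx.
Qed.

Definition commutant V := [set x | forall z, V z -> z ** x = x ** z].

Lemma commutant_subalgebra V : closed_subalgebra (commutant V).
Proof.
split.
- move=> x xV z Vz.
  have : lim_closed [set x | z ** x = x ** z].
    apply: (@lim_closed_eq _ _ (nrm z + nrm z)).
      by rewrite addr_ge0// nrm_ge0.
    move=> y w; rewrite (_ : _ - _ = z ** (y - w) - (y - w) ** z); last by nc.
    rewrite mulrDl (le_trans (nrmD _ _))// nrmN lerD ?nrmM//.
    by rewrite [leRHS]mulrC nrmM.
  by apply=> e /xV[y Vy xy]; exists y => //; exact: Vy.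
- by move=> x y Vx Vy z Vz; rewrite smulDr smulDl Vx// Vy.
- by move=> c x Vx z Vz; rewrite smulZr smulZl Vx.
- by move=> x y Vx Vy z Vz; rewrite smulA Vx// -smulA Vy// smulA.
Qed.

Lemma ideal_subalgebra V : closed_ideal V -> closed_subalgebra V.
Proof.
case=> cV V0 VD VZ VM; split => //; first exact: closed_lim_closed.
by move=> x y Vx Vy; have [] := VM x y Vy.
Qed.

End Subalgebras.

(** * Square roots *)

Section Roots.
Context (R : realType) (A : cstarAlgType R).
Implicit Types (u x y z : A) (V : set A).

(** In a commutative C*-algebra the modulus of a function dominates the moduli
of its real and imaginary parts; this is the only monotonicity of the norm
needed to replace the usual order on self-adjoint elements. *)
Lemma nrm_sqr_le_add x y : x^*s ** y = y^*s ** x ->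
  nrm x ^+ 2 <= nrm (x^*s ** x + y^*s ** y).
Proof.
move=> xy; set s := x^*s ** x + y^*s ** y.
have E (e : R[i]) : e = 'i \/ e = - 'i -> nrm (x + e *: y) ^+ 2 = nrm s.
  move=> ei; rewrite -nrmSM; congr nrm.
  have ce : Num.conj e = - e.
    by case: ei => ->; rewrite ?rmorphN; apply/eqP; rewrite eq_complex/= ?oppr0 ?opprK !eqxx.
  have ee : e * e = -1.
    by case: ei => ->; rewrite ?mulrNN -expr2 sqr_i.
  rewrite starD starZ ce !smulDl !smulDr !smulZl !smulZr xy scalerA mulNr ee opprK.
  by rewrite scale1r scaleNr /s; nc.
have xE : x = 2^-1 *: ((x + 'i *: y) + (x + (- 'i) *: y)) by nc.
have s0 : 0 <= nrm s by exact: nrm_ge0.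
have nE (e : R[i]) : e = 'i \/ e = - 'i -> nrm (x + e *: y) = Num.sqrt (nrm s).
  by move=> /E <-; rewrite sqrtr_sqr ger0_norm ?nrm_ge0.
rewrite -(sqr_sqrtr s0) ler_pXn2r ?nnegrE ?nrm_ge0 ?sqrtr_ge0//.
have -> : x = (2^-1 : R)%:C *: ((x + 'i *: y) + (x + (- 'i) *: y)).
  by rewrite {1}xE fmorphV rmorph_nat.
rewrite nrmZ ger0_norm ?invr_ge0// ler_pdivrMl//.
rewrite (le_trans (nrmD _ _))// !nE; [|by right|by left].
by rewrite mulr_natl mulr2n.
Qed.

Lemma nrm_half x : nrm (2^-1 *: x) = 2^-1 * nrm x.
Proof.
have -> : (2^-1 : R[i]) = (2^-1 : R)%:C by rewrite fmorphV rmorph_nat.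
by rewrite nrmZ ger0_norm// invr_ge0.
Qed.

(** The element [1 - (1 - u)^(1/2)], which makes sense without a unit. The
iteration [w := (u + w^2) / 2] is dominated by the same iteration for the
number [1], so it converges even in the boundary case [nrm u = 1].  Membership
in closed subalgebras stands for all that a functional calculus would give:
[w] commutes with what commutes with [u], is killed by what kills [u], and
belongs to the ideals that contain [u]. *)
Lemma half_root u : nrm u <= 1 -> exists w,
  [/\ w + w - w ** w = u, nrm w <= nrm u,
      forall V, closed_subalgebra V -> V u -> V w &
      u^*s = u -> w^*s = w].
Proof.
move=> u1; pose F x := 2^-1 *: (u + x ** x).
pose w := fix w n := if n is n.+1 then F (w n) else (0 : A).
pose c := fix c n := if n is n.+1 then 2^-1 * (1 + c n ^+ 2) else (0 : R).
have c01 n : 0 <= c n <= 1.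
  by elim: n => [|n /andP[]] /=; [rewrite lexx ler01|nra].
have wu n : nrm (w n) <= nrm u.
  elim: n => [|n IH] /=; first by rewrite nrm0 nrm_ge0.
  rewrite nrm_half (le_trans (ler_wpM2l _ (nrmD _ _)))//.
  have := nrmM (w n) (w n); have := nrm_ge0 (w n); nra.
have FB x y : F x - F y = 2^-1 *: (x ** (x - y) + (x - y) ** y).
  by rewrite /F; nc.
have FL x y (a b : R) : nrm x <= a -> nrm y <= b ->
    nrm (F x - F y) <= 2^-1 * (a + b) * nrm (x - y).
  move=> xa yb; rewrite FB nrm_half -mulrA ler_wpM2l//.
  rewrite (le_trans (nrmD _ _))// mulrDl lerD// (le_trans (nrmM _ _))//.
    by rewrite ler_wpM2r// nrm_ge0.
  by rewrite mulrC ler_wpM2r// nrm_ge0.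
have wc n : nrm (w n) <= c n /\ nrm (w n.+1 - w n) <= c n.+1 - c n.
  elim: n => [|n [IH1 IH2]].
    split; first by rewrite /= nrm0.
    rewrite /= subr0 /F nrm_half smul0l addr0 expr0n addr0 subr0 mulr1.
    by rewrite ler_piMr// invr_ge0.
  have IH3 : nrm (w n.+1) <= c n.+1.
    rewrite -(subrK (w n) (w n.+1)) (le_trans (nrmD _ _))//.
    by rewrite -(subrK (c n) (c n.+1)) lerD.
  split=> //; rewrite (le_trans (FL _ _ _ _ IH3 IH1))//.
  rewrite (le_trans (ler_wpM2l _ IH2))//.
    by case/andP: (c01 n) => ? _; case/andP: (c01 n.+1) => ? _; rewrite mulr_ge0// addr_ge0.
  have cE m : c m.+1 = 2^-1 * (1 + c m ^+ 2) by [].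
  have dE (a b : R) : 2^-1 * (a + b) * (a - b) =
      2^-1 * (1 + a ^+ 2) - 2^-1 * (1 + b ^+ 2) by field.
  by rewrite dE -!cE.
have [v wv] := @telescope_lim _ A w c 1 (fun n => (wc n).2) (fun n => (andP (c01 n)).2).
have vu : nrm v <= nrm u by apply: lim_to_nrm_le wv.
have Fv : F v = v.
  apply: (@lim_to_fixpoint _ _ F 1 w) wv => // n.
  rewrite (le_trans (FL _ _ _ _ (le_trans vu u1) (le_trans (wu n) u1)))//.
  by rewrite ler_wpM2r ?nrm_ge0//; lra.
exists v; split=> //.
- by rewrite -{1 2}Fv /F; nc.
- move=> V sV Vu; apply: lim_closed_lim (csa_lim sV) _ wv => n.
  elim: n => [|n IH] /=; first by rewrite -(scale0r u); exact: csaZ.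
  by apply: csaZ => //; apply: csaD => //; exact: csaM.
- move=> uu; have : lim_closed [set x : A | x^*s = x].
    apply: (@lim_closed_eq _ _ _ _ 2) => // x y.
    rewrite (_ : _ - _ = (x - y)^*s - (x - y)); last by rewrite starB; nc.
    by rewrite (le_trans (nrmD _ _))// nrmN nrm_star mulr_natl mulr2n.
  move/lim_closed_lim; apply; last exact: wv.
  elim=> [|n /= IH] /=; first exact: star0.
  rewrite /F starZ starD starM uu IH; congr (_ *: _).
  by rewrite fmorphV rmorph_nat.
Qed.

Lemma csa_commute x y z : (forall V, closed_subalgebra V -> V x -> V y) ->
  z ** x = x ** z -> z ** y = y ** z.
Proof.
move=> /(_ _ (commutant_subalgebra [set z])) xy zx.
by apply: xy => // _ ->.
Qed.

(** Here [1 - g] is [(1 + d)^(-1/2)]; the first equation is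
[(1 - g)(1 + d)(1 - g) = 1] multiplied out. *)
Lemma inverse_root (d : A) : nrm d <= 2^-1 -> exists g,
  [/\ g + g = d - g ** d - d ** g + g ** g + g ** d ** g,
      nrm g <= 2 * nrm d,
      forall V, closed_subalgebra V -> V d -> V g &
      d^*s = d -> g^*s = g].
Proof.
move=> d1; pose F x := d - x ** d.
pose w := fix w n := if n is n.+1 then F (w n) else (0 : A).
pose c n : R := 1 - 2^-1 ^+ n.
have FL x y : nrm (F x - F y) <= 2^-1 * nrm (x - y).
  rewrite (_ : _ - _ = (y - x) ** d); last by rewrite /F; nc.
  by rewrite (le_trans (nrmM _ _))// mulrC nrmB ler_wpM2r// nrm_ge0.
have wc n : nrm (w n.+1 - w n) <= c n.+1 - c n.
  have -> : c n.+1 - c n = 2^-1 ^+ n.+1 by rewrite /c exprS; field.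
  elim: n => [|n IH]; first by rewrite /= subr0 /F smul0l subr0 expr1.
  by rewrite (le_trans (FL _ _))// exprS ler_wpM2l.
have c1 n : c n <= 1 by rewrite gerBl exprn_ge0.
have [u wu] := @telescope_lim _ A w c 1 wc c1.
have Fu : F u = u.
  by apply: (@lim_to_fixpoint _ _ F 2^-1 w) wu.
have Vu V : closed_subalgebra V -> V d -> V u.
  move=> sV Vd; apply: lim_closed_lim (csa_lim sV) _ wu => n.
  elim: n => [|n IH] /=; first by rewrite -(scale0r d); exact: csaZ.
  by apply: csaB => //; exact: csaM.
have ud : nrm u <= 2 * nrm d.
  have : nrm u <= nrm d + nrm u * 2^-1.
    rewrite -{1}Fu (le_trans (nrmD _ _))// lerD// nrmN (le_trans (nrmM _ _))//.
    by rewrite ler_wpM2l// nrm_ge0.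
  lra.
have [|g [gE gu Vg sg]] := @half_root u; first by lra.
have cdu : u ** d = d ** u by symmetry; exact: csa_commute Vu _.
have cdg : g ** d = d ** g.
  by symmetry; apply: (csa_commute Vg); rewrite cdu.
exists g; split.
- have gg : g ** g = g + g - u by rewrite -gE; nc.
  have -> : g ** d ** g = d ** (g + g - u) by rewrite cdg -smulA gg.
  by rewrite cdg gg -{1}Fu /F cdu; nc.
- exact: le_trans gu ud.
- by move=> V sV Vd; apply: Vg => //; exact: Vu.
- move=> sd; apply: sg; apply/subr0_eq/nrm_eq0/le_anti.
  rewrite nrm_ge0 andbT.
  have E : u^*s - u = d ** (u - u^*s).
    by rewrite -{1 2}Fu /F starB starM sd cdu; nc.
  have : nrm (u^*s - u) <= 2^-1 * nrm (u^*s - u).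
    by rewrite {1}E (le_trans (nrmM _ _))// (nrmB u) ler_wpM2r// nrm_ge0.
  lra.
Qed.

End Roots.

(** * Cut-off functions of a self-adjoint element *)

Section Circle.
Context (R : realType) (A : cstarAlgType R).
Implicit Types (a t p w x y z : A) (V : set A).

Definition self_adjoint x := x^*s = x.

Lemma star_half x : (2^-1 *: x)^*s = 2^-1 *: x^*s.
Proof. by rewrite starZ; congr (_ *: _); rewrite fmorphV rmorph_nat. Qed.

(** The hypotheses say that [(1 - t)^2 + a^2 = 1], so that [1 - t] and [a] are
the cosine and the sine of an angle. *)
Lemma circle_contraction t a z : self_adjoint t -> self_adjoint a ->
  t ** a = a ** t -> a ** a = t + t - t ** t ->
  nrm (z - t ** z) <= nrm z /\ nrm (a ** z) <= nrm z.
Proof.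
move=> st sa ta aa; set x := z - t ** z; set y := a ** z.
have xx : x^*s ** x + y^*s ** y = z^*s ** z.
  rewrite /x /y starB !starM st sa.
  have -> : z^*s ** a ** (a ** z) = z^*s ** (a ** a) ** z by rewrite !smulA.
  by rewrite aa; nc.
have xy : x^*s ** y = y^*s ** x.
  rewrite /x /y starB !starM st sa.
  have -> : z^*s ** a ** (z - t ** z) = z^*s ** a ** z - z^*s ** (a ** t) ** z.
    by nc.
  by rewrite -ta; nc.
have le u : nrm u ^+ 2 <= nrm (z^*s ** z) -> nrm u <= nrm z.
  by rewrite nrmSM ler_pXn2r// nnegrE nrm_ge0.
split; apply: le; rewrite -xx; first exact: nrm_sqr_le_add.
by rewrite addrC; exact: nrm_sqr_le_add.
Qed.

Lemma nrm_le1_mul x : self_adjoint x -> nrm (x ** x) <= nrm x -> nrm x <= 1.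
Proof.
move=> sx; rewrite -{1}sx nrmSM.
by have := nrm_ge0 x; nra.
Qed.

Lemma half_root_fun : exists W : A -> A, forall u, nrm u <= 1 ->
  [/\ W u + W u - W u ** W u = u, nrm (W u) <= nrm u,
      forall V, closed_subalgebra V -> V u -> V (W u) &
      self_adjoint u -> self_adjoint (W u)].
Proof.
have /choice[W WP] u : exists w, nrm u <= 1 ->
  [/\ w + w - w ** w = u, nrm w <= nrm u,
      forall V, closed_subalgebra V -> V u -> V w &
      self_adjoint u -> self_adjoint w].
  have [/half_root[w wP]|_] := leP (nrm u) 1; first by exists w.
  by exists 0.
by exists W.
Qed.

End Circle.

Section Steps.
Context (R : realType) (A : cstarAlgType R) (W : A -> A).
Context (WP : forall u, nrm u <= 1 ->
  [/\ W u + W u - W u ** W u = u, nrm (W u) <= nrm u,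
      forall V, closed_subalgebra V -> V u -> V (W u) &
      self_adjoint u -> self_adjoint (W u)]).
Implicit Types (s : A * A) (V : set A).

(** A pair [s] of commuting elements is seen as an angle, at most straight,
given by [s.1 = 1 - cos] and [s.2 = sin].  Then [reflected s]
is [1 - |cos|], [cutoff s] is the negative part of [cos], and [rest s] is 1
minus the positive part of [cos]. *)
Definition angle s :=
  [/\ self_adjoint s.1, self_adjoint s.2, s.1 ** s.2 = s.2 ** s.1 &
      s.2 ** s.2 = s.1 + s.1 - s.1 ** s.1].

Definition reflected s := W (s.2 ** s.2).
Definition cutoff s := 2^-1 *: (s.1 - reflected s).
Definition rest s := 2^-1 *: (s.1 + reflected s).
Definition double s : A * A :=
  (rest s + rest s + (rest s + rest s)
     - (rest s ** rest s + rest s ** rest s),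
   (s.2 - rest s ** s.2) + (s.2 - rest s ** s.2)).

Section Angle.
Context (s : A * A) (sP : angle s).
Local Notation t := s.1.
Local Notation a := s.2.
Local Notation w := (reflected s).
Local Notation p := (cutoff s).
Local Notation y := (rest s).

Let st : self_adjoint t. Proof. by case: sP. Qed.
Let sa : self_adjoint a. Proof. by case: sP. Qed.
Let ta : t ** a = a ** t. Proof. by case: sP. Qed.
Let aa : a ** a = t + t - t ** t. Proof. by case: sP. Qed.
Let tt : t ** t = t + t - a ** a. Proof. by rewrite aa; nc. Qed.

Lemma angle_le1 : nrm a <= 1.
Proof.
apply: nrm_le1_mul => //.
by have [] := circle_contraction a st sa ta aa.
Qed.

Let aa1 : nrm (a ** a) <= 1.
Proof. by rewrite -{1}sa nrmSM expr_le1// ?angle_le1// nrm_ge0. Qed.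

Lemma reflected_root : w + w - w ** w = a ** a.
Proof. by case: (WP aa1). Qed.

Let ww : w ** w = w + w - a ** a.
Proof. by rewrite -reflected_root; nc. Qed.

Lemma reflected_le1 : nrm w <= 1.
Proof. by case: (WP aa1) => _ /le_trans->. Qed.

Lemma reflected_mem V : closed_subalgebra V -> V a -> V w.
Proof. by move=> sV Va; case: (WP aa1) => _ _ /(_ V sV) + _; apply; exact: csaM. Qed.

Lemma reflected_sa : self_adjoint w.
Proof. by case: (WP aa1) => _ _ _; apply; rewrite /self_adjoint starM sa. Qed.

Let tw : t ** w = w ** t.
Proof. by apply: csa_commute ta => V; exact: reflected_mem. Qed.

Let aw : a ** w = w ** a.
Proof. by apply: (@csa_commute _ _ a) => // V; exact: reflected_mem. Qed.

Lemma cutoff_sa : self_adjoint p.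
Proof. by rewrite /self_adjoint star_half starB st reflected_sa. Qed.

Lemma rest_sa : self_adjoint y.
Proof. by rewrite /self_adjoint star_half starD st reflected_sa. Qed.

Let ay : a ** y = y ** a.
Proof. by rewrite /rest smulZr smulZl smulDr smulDl ta aw. Qed.

(** The positive and the negative part of the cosine have product 0. *)
Lemma cutoff_rest : p ** y = p.
Proof.
have -> : p ** y = 4^-1 *: (t ** t + t ** w - w ** t - w ** w).
  by rewrite /cutoff /rest; nc.
by rewrite tw tt ww /cutoff; nc.
Qed.

Lemma rest_cutoff : y ** p = p.
Proof. by have := congr1 (@star R A) cutoff_rest; rewrite starM rest_sa cutoff_sa. Qed.

Lemma cutoff_le1 : nrm p <= 1.
Proof.
apply: nrm_le1_mul; first exact: cutoff_sa.
have -> : p ** p = 2^-1 *: ((p - w ** p) - (p - t ** p)).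
  by rewrite {1}/cutoff; nc.
rewrite nrm_half ler_pdivrMl// mulr_natl mulr2n (le_trans (nrmD _ _))//.
rewrite nrmN lerD//.
  have aaw : a ** a = w + w - w ** w by rewrite reflected_root.
  by have [] := circle_contraction p reflected_sa sa (esym aw) aaw.
by have [] := circle_contraction p st sa ta aa.
Qed.

(** With [c = 1 - y] the positive part of the cosine, [double s] has cosine
[2 c^2 - 1] and sine [2 c a]: the angle is doubled, and stays straight once it
is obtuse.  On acute angles this is the usual formula; where the angle is
obtuse [c] vanishes. *)
Lemma double_angle : angle (double s).
Proof.
have yy : self_adjoint (y ** y) by rewrite /self_adjoint starM rest_sa.
have aay : a ** a = y + y - y ** y - p ** p.
  transitivity (2^-1 *: (a ** a + a ** a)); first by nc.
  by rewrite {1}aa -reflected_root /cutoff /rest; nc.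
have yt' : y ** (double s).1 = (double s).1 ** y by rewrite /=; nc.
have at' : a ** (double s).1 = (double s).1 ** a.
  have sV := commutant_subalgebra [set a].
  have Vy : commutant [set a] y by move=> _ ->.
  have : commutant [set a] (double s).1.
    have Vyy := csaD sV Vy Vy; have Vy2 := csaM sV Vy Vy.
    exact: csaB sV _ _ (csaD sV Vyy Vyy) (csaD sV Vy2 Vy2).
  by apply.
split.
- by rewrite /self_adjoint /= starB !starD yy rest_sa.
- by rewrite /self_adjoint /= starD starB starM rest_sa sa ay.
- have comm : (double s).1 ** (a - y ** a) = (a - y ** a) ** (double s).1.
    move: (double s).1 yt' at' => x yx ax.
    by rewrite smulBr smulBl smulA -ax -yx -!smulA -ax.
  have add2 (x z : A) : x ** z = z ** x -> x ** (z + z) = (z + z) ** x.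
    by rewrite smulDr smulDl => ->.
  exact: add2.
- have sq : (a - y ** a) ** (a - y ** a)
      = y + y - y ** y - (y + y - y ** y) ** y - y ** (y + y - y ** y)
        + y ** (y + y - y ** y) ** y.
    transitivity
      (a ** a - (a ** a) ** y - y ** (a ** a) + y ** (a ** a) ** y).
      by rewrite -{2}ay; nc.
    have py : p ** p ** y = p ** p by rewrite -smulA cutoff_rest.
    have yp : y ** (p ** p) = p ** p by rewrite smulA rest_cutoff.
    by rewrite aay !(smulBl, smulBr) !(py, yp); nc.
  have -> : (double s).2 ** (double s).2
      = 4 *: ((a - y ** a) ** (a - y ** a)) by rewrite /=; nc.
  by rewrite sq /=; nc.
Qed.

Lemma cutoff_rest_double :
  [/\ p ** (double s).1 = p + p & p ** (double s).2 = 0].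
Proof.
split; rewrite /= !(smulBr, smulDr) !smulA !cutoff_rest; first by nc.
by rewrite !subrr addr0.
Qed.

End Angle.

(** Where the cosine is negative the doubled angle is straight, and there the
next cut-off is 1. *)
Lemma cutoff_double s : angle s -> cutoff s ** cutoff (double s) = cutoff s.
Proof.
move=> sP; have [pt pa] := cutoff_rest_double sP.
have pw : cutoff s ** reflected (double s) = 0.
  apply: (reflected_mem (double_angle sP) (annihilator_subalgebra _)).
  exact: pa.
rewrite {2}/cutoff smulZr smulBr pt pw; nc.
Qed.

Lemma double_mem s V : angle s -> closed_subalgebra V -> V s.1 -> V s.2 ->
  [/\ V (cutoff s), V (double s).1 & V (double s).2].
Proof.
move=> sP sV Vt Va; have Vw := reflected_mem sP sV Va.
have Vy : V (rest s) by apply: csaZ => //; exact: csaD.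
have Vyy := csaD sV Vy Vy; have Vy2 := csaM sV Vy Vy.
split; first by apply: csaZ => //; exact: csaB.
  exact: csaB sV _ _ (csaD sV Vyy Vyy) (csaD sV Vy2 Vy2).
have Vb := csaB sV Va (csaM sV Vy Va).
exact: csaD.
Qed.

(** Modulo an ideal that contains every cut-off, doubling the angle is
multiplication by 2 up to second order; as angles stay bounded they must
vanish. *)
Lemma cutoff_ideal (I : set A) (s : nat -> A * A) : closed_ideal I ->
  (forall n, angle (s n)) -> (forall n, s n.+1 = double (s n)) ->
  (forall n, I (cutoff (s n))) -> I (s 0%N).2.
Proof.
move=> iI sP sS Ip; have sI := ideal_subalgebra iI.
pose D x (r : R) := exists2 z, I z & nrm (x - z) <= r.
have D0 x (r : R) : 0 <= r -> r < 1 -> (forall k, D x (r ^+ k)) -> I x.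
  move=> r0 r1 xr; apply: (csa_lim sI) => e e0.
  have [k ke] := expr_small r0 r1 e0.
  by have [z Iz xz] := xr k; exists z => //; exact: le_lt_trans ke.
(* With [t' = 4 t - 2 t^2] modulo [I], a bound [r <= 1] for the classes of all
[s n] improves to [(r + 2 r^2) / 4 <= 3 / 4 * r]. *)
have It n : I (s n).1.
  apply: (D0 _ (3 / 4)); [lra|lra|] => k.
  elim: k n => [|k IH] n.
    exists (cutoff (s n) + cutoff (s n)); first exact: csaD.
    rewrite expr0; have := reflected_le1 (sP n).
    by apply: le_trans; rewrite le_eqVlt /cutoff; apply/orP; left; apply/eqP;
       congr nrm; nc.
  pose r : R := (3 / 4) ^+ k; have r0 : 0 <= r by rewrite exprn_ge0//; lra.
  have r1 : r <= 1 by rewrite exprn_ile1//; lra.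
  have [z Iz tz] := IH n; have [z' Iz' tz'] := IH n.+1.
  have := Ip n; move: (sS n) tz tz'; set p := cutoff (s n).
  set t := (s n).1; set t' := (s n.+1).1 => sn tz tz' pI.
  have tE : t' = 4 *: t - 4 *: p
      - 2 *: (t ** t - t ** p - p ** t + p ** p).
    have -> : t' = (double (s n)).1 by rewrite -sn.
    have yE : rest (s n) = t - p.
      by rewrite /p /t /rest /cutoff; nc.
    by rewrite /= yE; nc.
  have Il x : I (x ** p) by case: iI => _ _ _ _ /(_ x p pI)[].
  have Ilz x : I (x ** z) by case: iI => _ _ _ _ /(_ x z Iz)[].
  have Irz x : I (z ** x) by case: iI => _ _ _ _ /(_ x z Iz)[].
  have Ir x : I (p ** x) by case: iI => _ _ _ _ /(_ x p pI)[].
  exists (4^-1 *: (z' + 2 *: (z ** t + t ** z - z ** z)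
     + (4 *: p + 2 *: (p ** p - t ** p - p ** t)))).
    apply: csaZ => //; apply: (csaD sI).
      by apply: (csaD sI) => //; apply: csaZ => //; apply: (csaB sI) => //; exact: csaD.
    apply: (csaD sI); first exact: csaZ.
    by apply: csaZ => //; apply: (csaB sI) => //; exact: csaB.
  have -> : t - 4^-1 *: (z' + 2 *: (z ** t + t ** z - z ** z)
     + (4 *: p + 2 *: (p ** p - t ** p - p ** t)))
     = 2^-1 *: (2^-1 *: (t' - z') + (t - z) ** (t - z)) by rewrite tE; nc.
  rewrite nrm_half exprS -/r (le_trans (ler_wpM2l _ (nrmD _ _)))//.
  rewrite nrm_half; have := nrmM (t - z) (t - z); have := nrm_ge0 (t - z).
  rewrite -/r in tz tz'; nra.
(* Now the sines double exactly modulo [I], while their norms stay below 1. *)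
suff Da k n : D (s n).2 (2^-1 ^+ k) by apply: (D0 _ 2^-1) => //; lra.
elim: k n => [|k IH] n.
  exists 0; first by rewrite -(scale0r (s n).1); exact: csaZ.
  by rewrite subr0 expr0 angle_le1.
have [z Iz az] := IH n.+1.
have Iy : I (rest (s n)).
  have -> : rest (s n) = (s n).1 - cutoff (s n) by rewrite /rest /cutoff; nc.
  exact: csaB.
have Iya : I (rest (s n) ** (s n).2).
  by case: iI => _ _ _ _ /(_ (s n).2 _ Iy)[].
exists (2^-1 *: z + rest (s n) ** (s n).2).
  by apply: csaD => //; exact: csaZ.
rewrite exprS [X in nrm X](_ : _ = 2^-1 *: ((s n.+1).2 - z)).
  by rewrite nrm_half ler_wpM2l.
by rewrite sS /=; nc.
Qed.

End Steps.

(** Successive doublings of the angle with sine [b] have cut-offs with increasing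
supports; the enumeration begins at one outside [I]. *)
Lemma cutoff_functions_contraction (R : realType) (A : cstarAlgType R) (I : set A) (b : A) :
  closed_ideal I -> self_adjoint b -> nrm b <= 1 -> ~ I b ->
  exists p : nat -> A,
    [/\ forall n, self_adjoint (p n) /\ nrm (p n) <= 1,
        forall n, p n ** p n.+1 = p n /\ p n.+1 ** p n = p n,
        ~ I (p 0%N) &
        forall V n, closed_subalgebra V -> V b -> V (p n)].
Proof.
move=> iI sb b1 Ib; have [W WP] := half_root_fun A.
pose s n := iter n (double W) (W (b ** b), b).
have bb1 : nrm (b ** b) <= 1 by rewrite -{1}sb nrmSM expr_le1// nrm_ge0.
have sP n : angle (s n).
  elim: n => [|n IH]; last exact: double_angle.
  have [WE _ WV Wsa] := WP _ bb1; split=> //=.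
    by apply: Wsa; rewrite /self_adjoint starM sb.
  by symmetry; apply: csa_commute WV _; rewrite smulA.
have sV V n : closed_subalgebra V -> V b -> V (s n).1 /\ V (s n).2.
  move=> cV Vb; elim: n => [|n [IH1 IH2]].
    by have [_ _ WV _] := WP _ bb1; split=> //; apply: WV => //; exact: csaM.
  by have [] := double_mem WP (sP n) cV IH1 IH2.
have [J IJ] : exists J, ~ I (cutoff W (s J)).
  apply/existsNP => Ip; apply: Ib.
  exact: (@cutoff_ideal _ _ W WP I s iI sP (fun n => erefl) Ip).
exists (fun n => cutoff W (s (n + J)%N)); split=> //.
- by move=> n; split; [exact: cutoff_sa|exact: cutoff_le1].
- move=> n; have pp := cutoff_double WP (sP (n + J)%N).
  split=> //; have := congr1 (@star R A) pp; rewrite starM.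
  by rewrite !(cutoff_sa WP (sP _)) (cutoff_sa WP (sP (n + J).+1)).
- move=> V n cV Vb; have [Vt Va] := sV V (n + J)%N cV Vb.
  by have [] := double_mem WP (sP _) cV Vt Va.
Qed.

(** * Infinite projections *)

Section Ideals.
Context (R : realType) (A : cstarAlgType R).
Implicit Types (x y z : A) (I : set A).

Definition ideal_of x : set A := smallest (@closed_ideal R A) [set x].

Lemma ideal_of_closed x : closed_ideal (ideal_of x).
Proof.
split.
- move=> y yc I [cI xI]; have [clI _ _ _ _] := cI.
  by apply: clI => B /yc[z [zx Bz]]; exists z; split=> //; exact: zx.
- by move=> I [[]].
- by move=> y z yx zx I xI; have [[_ _ + _ _] _] := xI; apply; [exact: yx|exact: zx].
- by move=> c y yx I xI; have [[_ _ _ + _] _] := xI; apply; exact: yx.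
- by move=> a y yx; split=> I xI; have [[_ _ _ _ IM] _] := xI; have [] := IM a y (yx _ xI).
Qed.

Lemma ideal_of_self x : ideal_of x x.
Proof. by move=> I [_]; apply. Qed.

Lemma ideal_of_sub x I : closed_ideal I -> I x -> ideal_of x `<=` I.
Proof. by move=> iI Ix y; apply; split=> // _ ->. Qed.

Lemma idealMl I x y : closed_ideal I -> I y -> I (x ** y).
Proof. by case=> _ _ _ _ IM Iy; case: (IM x y Iy). Qed.

Lemma idealMr I x y : closed_ideal I -> I x -> I (x ** y).
Proof. by case=> _ _ _ _ IM Ix; case: (IM y x Ix). Qed.

Lemma ideal0 I : closed_ideal I -> I 0.
Proof. by case. Qed.

Lemma zero_ideal : closed_ideal [set (0 : A)].
Proof.
split=> //=.
- move=> x x0; rewrite /set1/=; apply: (@nrm_small_eq0 R A) => e e0.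
  have [|y /= [-> xy]] := x0 (ball x e%:C).
    by apply: nbhsx_ballx; exact: complex_gt0.
  by move: xy; rewrite -ball_normE/= subr0 nrmE ltcR => /ltW.
- by move=> x y -> ->; rewrite addr0.
- by move=> c x ->; rewrite scaler0.
- by move=> a x ->; rewrite smul0l smul0r.
Qed.

End Ideals.
Arguments ideal_of_self {R A} x.

Section Projections.
Context (R : realType) (A : cstarAlgType R).
Implicit Types (p q s x y z : A).

Lemma projection_le1 p : is_projection p -> nrm p <= 1.
Proof. by case=> pp sp; apply: nrm_le1_mul; rewrite ?pp. Qed.

(** The form in which pure infiniteness is used: the positive element of the
corner of [e] that approximates [y] comes factored. *)
Lemma compare e y (eps : R) : purely_infinite A -> self_adjoint e ->
  cstar_positive y -> ideal_of (e ** e) y -> 0 < eps ->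
  exists d, nrm ((e ** d)^*s ** (e ** d) - y) < eps.
Proof.
move=> [_ cmp] se py ey eps0.
have pe : cstar_positive (e ** e) by exists e; rewrite se.
have [a /cvg_lim_to/(_ _ eps0)[N /(_ N (leqnn N))]] := cmp _ _ pe py ey.
rewrite -(_ : (e ** (a N)^*s)^*s ** (e ** (a N)^*s) = a N ** (e ** e) ** (a N)^*s).
  by move=> aN; exists (a N)^*s.
by rewrite starM starK se !smulA.
Qed.

(** Polar decomposition: [1 - g] is the inverse square root of [x* x] in the
corner of [s], where [x* x] is close to the unit [s]. *)
Lemma near_partial_isometry s x : is_projection s -> x ** s = x ->
  nrm (x^*s ** x - s) <= 2^-1 ->
  exists g, (x - x ** g)^*s ** (x - x ** g) = s.
Proof.
move=> [ss sa] xs; set d := x^*s ** x - s => d1.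
have [g [gE _ Vg sg]] := inverse_root d1.
have sd : d^*s = d by rewrite /d starB starM starK sa.
have sx : s ** x^*s = x^*s by rewrite -{2}xs starM sa.
have sdd : s ** d = d by rewrite /d smulBr ss smulA sx.
have sgg : s ** g = g by exact: (Vg _ (fixer_subalgebra s) sdd).
have gs : g ** s = g.
  by have := congr1 (@star R A) sgg; rewrite starM (sg sd) sa.
have xx : x^*s ** x = s + d by rewrite /d; nc.
clearbody d.
exists g; rewrite starB starM (sg sd).
have -> : (x^*s - g ** x^*s) ** (x - x ** g)
  = x^*s ** x - (x^*s ** x) ** g - g ** (x^*s ** x)
    + g ** (x^*s ** x) ** g by nc.
rewrite xx !(smulDl, smulDr) sgg gs.
transitivity (s + (d - g ** d - d ** g + g ** g + g ** d ** g) - (g + g)).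
  by nc.
by rewrite -gE; nc.
Qed.

(** The hypothesis says that [v = 1 + y] is an isometry.  Then [p] is
[1 - v v*] and [z] is [v p]. *)
Lemma isometry_defect y : y + y^*s + y^*s ** y = 0 ->
  exists p z, [/\ p = - (y + y^*s + y ** y^*s), is_projection p,
    z^*s ** z = p & p ** z = 0].
Proof.
move=> yy; pose p := - (y + y^*s + y ** y^*s).
have y2 : y^*s ** y = - (y + y^*s) by apply/eqP; rewrite -addr_eq0 addrC yy.
have sp : p^*s = p by rewrite /p starN !starD starM starK; nc.
have py : p ** y = - p.
  have -> : p ** y = - (y ** y + y^*s ** y + y ** (y^*s ** y)) by rewrite /p; nc.
  by rewrite y2 /p; nc.
have yp : y^*s ** p = - p.
  by have := congr1 (@star R A) py; rewrite starM sp starN sp.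
have pp : p ** p = p.
  have -> : p ** p = - (y ** p + y^*s ** p + y ** (y^*s ** p)) by rewrite {1}/p; nc.
  by rewrite yp; nc.
have pE : p = - (y + y^*s + y ** y^*s) by [].
clearbody p; exists p, (p + y ** p); split=> //.
- rewrite starD starM sp.
  have -> : (p + p ** y^*s) ** (p + y ** p)
    = p ** p + p ** (y + y^*s + y^*s ** y) ** p by nc.
  by rewrite yy pp; nc.
- by rewrite smulDr smulA py smulNl pp; nc.
Qed.

(** A projection [p] together with a disjoint copy of itself generates the
same ideal as [p], so it is a copy of a part of [p]. *)
Lemma disjoint_copy_infinite p z : purely_infinite A ->
  is_projection p -> p != 0 -> z^*s ** z = p -> p ** z = 0 ->
  exists s : A, infinite_projection s.
Proof.
move=> piA [pp sp] p0 zz pz; pose q := z ** z^*s; pose s := p + q.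
have zp : z ** p = z.
  apply/esym/subr0_eq/starM_eq0; rewrite starB starM sp.
  have -> : (z^*s - p ** z^*s) ** (z - z ** p)
    = z^*s ** z - (z^*s ** z) ** p - p ** (z^*s ** z) + p ** (z^*s ** z) ** p.
    by nc.
  by rewrite zz !pp; nc.
have sq : q^*s = q by rewrite /q starM starK.
have pq : p ** q = 0 by rewrite /q smulA pz smul0l.
have qp : q ** p = 0 by have := congr1 (@star R A) pq; rewrite starM sp sq star0.
have qq : q ** q = q by rewrite /q smulA -(smulA z) zz zp.
have ss : is_projection s.
  by split; rewrite /s ?starD ?sp ?sq// smulDl !smulDr pp pq qp qq addr0 add0r.
have sI : ideal_of (p ** p) s.
  rewrite pp; have iI := @ideal_of_closed _ _ p; have pI := ideal_of_self p.
  have [_ _ D _ _] := iI; apply: D => //.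
  have -> : q = z ** (p ** z^*s) by rewrite smulA zp.
  exact: (idealMl z iI (idealMr _ iI pI)).
have ps : cstar_positive s by exists s; case: ss => ss ->.
have h0 : 0 < 2^-1 :> R by rewrite invr_gt0.
have [d dE] := compare piA sp ps sI h0.
pose x := p ** d ** s; have [sss sas] := ss.
have xs : x ** s = x by rewrite /x -smulA sss.
have xd : nrm (x^*s ** x - s) <= 2^-1.
  have -> : x^*s ** x - s = s ** ((p ** d)^*s ** (p ** d) - s) ** s.
    by rewrite /x starM sas smulBr smulBl sss sss !smulA.
  have s1 := projection_le1 ss.
  rewrite (le_trans (nrmM _ _))// (le_trans (ler_piMr _ s1)) ?nrm_ge0//.
  rewrite (le_trans (nrmM _ _))// (le_trans (ler_piMl _ s1)) ?nrm_ge0//.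
  exact: ltW.
have [g xE] := near_partial_isometry ss xs xd.
set v := x - x ** g in xE.
have pv : p ** v = v by rewrite /v /x smulBr !smulA pp.
have vs : v ** s = v.
  apply/esym/subr0_eq/starM_eq0; rewrite starB starM sas.
  have -> : (v^*s - s ** v^*s) ** (v - v ** s)
    = v^*s ** v - (v^*s ** v) ** s - s ** (v^*s ** v) + s ** (v^*s ** v) ** s.
    by nc.
  by rewrite xE !sss; nc.
have qv : q ** v = 0 by rewrite -pv smulA qp smul0l.
have sv : s ** v = v by rewrite [s ** v]smulDl pv qv addr0.
exists s; split=> //; exists (v ** v^*s); split.
- split; first by rewrite smulA -(smulA v) xE vs.
  by rewrite starM starK.
- by rewrite /subprojection smulA sv.
- move=> vE; have : p ** s = s by rewrite -vE smulA pv.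
  rewrite /s smulDr pp pq => /addrI q0.
  move/eqP: p0; apply; rewrite -pp -{1}zz -smulA.
  by have := starM_eq0 (x := z^*s); rewrite starK -/q -q0 => /(_ erefl) ->; rewrite smul0l.
- by exists v.
Qed.

(** If [k = f^2] is compressed by [e d] into the corner of [e], where [f] is 1,
then [1 - w + e d], with [(1 - w)^2 = 1 - k], is almost an isometry; its range
misses [c], because [c] lives where [1 - w] and [m] vanish. *)
Lemma compression_infinite (e m c f : A) : purely_infinite A ->
  self_adjoint e -> self_adjoint m -> self_adjoint c -> self_adjoint f ->
  nrm f <= 1 -> m ** e = e -> c ** m = 0 -> c != 0 -> f ** m = m ->
  f ** c = c -> ideal_of (e ** e) (f ** f) ->
  exists s : A, infinite_projection s.
Proof.
move=> piA se sm sc sf f1 me cm c0 fm fc ef.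
have ff1 : nrm (f ** f) <= 1 by rewrite -{1}sf nrmSM expr_le1// nrm_ge0.
have [w [wE _ _ sw]] := half_root ff1.
have {}sw : w^*s = w by apply: sw; rewrite starM sf.
have fixw z : f ** z = z -> w ** z = z.
  move=> fz; apply/esym/subr0_eq/starM_eq0; rewrite starB starM sw.
  have -> : (z^*s - z^*s ** w) ** (z - w ** z)
    = z^*s ** (z - (w + w - w ** w) ** z) by nc.
  by rewrite wE -smulA !fz subrr smul0r.
have wm := fixw _ fm.
have cw : c ** w = c.
  by have := congr1 (@star R A) (fixw _ fc); rewrite starM sw sc.
have h0 : 0 < 2^-1 :> R by rewrite invr_gt0.
have pf : cstar_positive (f ** f) by exists f; rewrite sf.
have [d dE] := compare piA se pf ef h0.
set x := e ** d in dE.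
have mx : m ** x = x by rewrite /x smulA me.
have cx : c ** x = 0 by rewrite -mx smulA cm smul0l.
have wx : w ** x = x by rewrite -mx smulA wm.
have xw : x^*s ** w = x^*s by rewrite -{2}wx starM sw.
clearbody x.
pose y := x - w; pose D := x^*s ** x - f ** f.
have yD : y + y^*s + y^*s ** y = D.
  rewrite /y /D -wE starB sw.
  have -> : (x^*s - w) ** (x - w) = x^*s ** x - x^*s ** w - w ** x + w ** w.
    by nc.
  by rewrite xw wx; nc.
have [g [gE _ _ sg]] := inverse_root (ltW dE : nrm D <= 2^-1).
have {}sg : g^*s = g by apply: sg; rewrite /D starB !starM starK sf.
have cy : c ** y = - c by rewrite /y smulBr cx cw sub0r.
clearbody y D.
pose v := y - g - y ** g.
have vv : v + v^*s + v^*s ** v = 0.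
  rewrite /v !starB starM sg.
  have -> : y - g - y ** g + (y^*s - g - g ** y^*s) +
     (y^*s - g - g ** y^*s) ** (y - g - y ** g)
    = (y + y^*s + y^*s ** y) - g ** (y + y^*s + y^*s ** y)
      - (y + y^*s + y^*s ** y) ** g + g ** (y + y^*s + y^*s ** y) ** g
      + g ** g - (g + g) by nc.
  by rewrite yD gE; nc.
have [p [z [pE pP zz pz]]] := isometry_defect vv.
apply: (disjoint_copy_infinite piA pP _ zz pz).
apply: contra_neq c0 => p0.
have cv : c ** v = - c by rewrite /v !smulBr (smulA c) cy; nc.
clearbody v; have -> : c = c ** p.
  by rewrite pE smulNr !smulDr smulA cv; nc.
by rewrite p0 smul0r.
Qed.

End Projections.

(** * Corners without zero divisors *)

Section Corner.
Context (R : realType) (A : cstarAlgType R).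
Implicit Types (a b q r u x y z : A).

(** In the corner of [q] the element 1 exists, so [half_root] gives a genuine
square root there, namely of [q - u]. *)
Lemma corner_root q u : is_projection q -> self_adjoint u -> q ** u = u ->
  nrm u <= 1 -> exists r,
  [/\ self_adjoint r, q ** r = r, r ** r = q - u, nrm (q - r) <= nrm u &
      forall z, z ** q = q ** z -> z ** u = u ** z -> z ** r = r ** z].
Proof.
move=> [qq sq] su qu u1; have [w [wE wu Vw sw]] := half_root u1.
have {}sw : w^*s = w by exact: sw.
have qw : q ** w = w by exact: (Vw _ (fixer_subalgebra q) qu).
have wq : w ** q = w by have := congr1 (@star R A) qw; rewrite starM sw sq.
exists (q - w); split.
- by rewrite /self_adjoint starB sq sw.
- by rewrite smulBr qq qw.
- by rewrite !(smulBl, smulBr) qq qw wq -wE; nc.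
- by rewrite [X in nrm X](_ : _ = w)//; nc.
- by move=> z zq zu; rewrite smulBr smulBl zq (csa_commute Vw zu).
Qed.

(** The intervals [s n - d n, s n + d n] are nested. *)
Lemma nested_intervals (s d : nat -> R) :
  (forall n, 0 <= d n) -> (forall n, `|s n.+1 - s n| <= d n - d n.+1) ->
  exists l, forall n, `|l - s n| <= d n.
Proof.
move=> d0 sd.
have lo n k : s n - d n <= s (n + k)%N - d (n + k)%N.
  elim: k => [|k IH]; first by rewrite addn0.
  by rewrite addnS (le_trans IH)//; have := sd (n + k)%N; rewrite ler_norml; lra.
have hi n k : s (n + k)%N + d (n + k)%N <= s n + d n.
  elim: k => [|k IH]; first by rewrite addn0.
  by rewrite addnS (le_trans _ IH)//; have := sd (n + k)%N; rewrite ler_norml; lra.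
have ub n : ubound (range (fun k => s k - d k)) (s n + d n).
  move=> _ [k _ <-]; have [kn|nk] := leqP k n.
    by have := lo k (n - k)%N; rewrite subnKC//; have := d0 n; lra.
  by have := hi n (k - n)%N; rewrite subnKC 1?ltnW//; have := d0 k; lra.
have hs : has_sup (range (fun k => s k - d k)).
  by split; [exists (s 0%N - d 0%N), 0%N|exists (s 0%N + d 0%N)].
exists (sup (range (fun k => s k - d k))) => n.
have h1 : s n - d n <= sup (range (fun k => s k - d k)).
  by apply: ub_le_sup; [case: hs|exists n].
have h2 := ge_sup (proj1 hs) (ub n).
by rewrite ler_norml; apply/andP; split; lra.
Qed.

Section NoZeroDivisor.
Context (q : A) (qP : is_projection q).
Context (nozd : forall b z,
  self_adjoint b -> b != 0 -> q ** b = b -> z ** b = 0 -> z ** q = 0).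

(** With [M] the modulus of [b], [(M - b)(M + b) = 0] forces [b] to be positive
or negative.  So its spectrum fills at most half of the interval that the norm
allows, and [l] is the midpoint of that half. *)
Lemma halve_distance b : self_adjoint b -> q ** b = b ->
  exists l : R, nrm (b - l%:C *: q) <= 2^-1 * nrm b.
Proof.
have [qq sq] := qP; have q1 := projection_le1 qP.
move=> sb qb; have [->|b0] := eqVneq b 0.
  by exists 0; rewrite scale0r subr0 nrm0 mulr0.
have n0 := nrm_gt0 b0.
have left x : self_adjoint x -> q ** x = x -> x ** q = x.
  by move=> sx /(congr1 (@star R A)); rewrite starM sx sq.
pose S := (nrm b)^-1%:C *: b.
have bS : b = (nrm b)%:C *: S.
  by rewrite /S scalerA -rmorphM/= mulfV ?gt_eqF// scale1r.
have S1 : nrm S = 1 by rewrite nrmZ ger0_norm ?invr_ge0 ?nrm_ge0// mulVf// gt_eqF.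
have sS : self_adjoint S by rewrite /self_adjoint /S starZr sb.
have qS : q ** S = S by rewrite /S smulZr qb.
clearbody S; have Sq := left _ sS qS.
have SS1 : nrm (S ** S) <= 1 by rewrite -{1}sS nrmSM S1 expr1n.
have sSS : self_adjoint (S ** S) by rewrite /self_adjoint starM sS.
have [L [sL qL LL _ cL]] := corner_root qP sSS (etrans (smulA _ _ _) (congr1 (smul^~ S) qS)) SS1.
have Lq := left _ sL qL.
have SL : S ** L = L ** S by apply: cL; rewrite ?Sq ?qS// smulA.
have le1 x y : self_adjoint x -> self_adjoint y -> x ** y = y ** x ->
    x ** x + y ** y = q -> nrm x <= 1.
  move=> sx sy xy xyq; rewrite -(@expr_le1 _ 2)// ?nrm_ge0//.
  have := nrm_sqr_le_add (x := x) (y := y).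
  by rewrite sx sy xyq => /(_ xy)/le_trans; apply.
have L1 : nrm L <= 1 by apply: (le1 _ S) => //; rewrite LL subrK.
have LL1 : nrm (L ** L) <= 1 by rewrite -{1}sL nrmSM expr_le1// nrm_ge0.
have sLL : self_adjoint (L ** L) by rewrite /self_adjoint starM sL.
have [M [sM qM MM M1 cM]] := corner_root qP sLL (etrans (smulA _ _ _) (congr1 (smul^~ L) qL)) LL1.
have Mq := left _ sM qM.
have SM : S ** M = M ** S.
  by apply: cM; rewrite ?Sq ?qS// smulA SL -!smulA SL.
have LM : L ** M = M ** L by apply: cM; rewrite ?Lq ?qL// smulA.
have MMS : M ** M = S ** S by rewrite MM LL; nc.
have M01 : nrm M <= 1 by apply: (le1 _ L) => //; rewrite MM subrK.
have sqM : self_adjoint (q - M) by rewrite /self_adjoint starB sq sM.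
have qqM : q ** (q - M) = q - M by rewrite smulBr qq qM.
have [K [sK qK KK _ cK]] := corner_root qP sqM qqM (le_trans M1 LL1).
have [N [sN qN NN _ cN]] := corner_root qP sM qM M01.
have Kq := left _ sK qK; have Nq := left _ sN qN.
have {}KK : K ** K = M by rewrite KK; nc.
have KM : K ** M = M ** K by rewrite -KK smulA.
have KN : K ** N = N ** K by apply: cN; rewrite ?Kq ?qK.
have MN : M ** N = N ** M by apply: cN; rewrite ?Mq ?qM.
have half : nrm (M - 2^-1 *: q) <= 2^-1.
  have sh : self_adjoint (M - 2^-1 *: q).
    by rewrite /self_adjoint starB sM star_half sq.
  have sKN : self_adjoint (K ** N) by rewrite /self_adjoint starM sK sN KN.
  have comm : (M - 2^-1 *: q) ** (K ** N) = (K ** N) ** (M - 2^-1 *: q).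
    rewrite smulBl smulBr smulZl smulZr !smulA qK -!smulA Nq; congr (_ - _).
    by rewrite smulA -KM -smulA MN.
  have sum : (M - 2^-1 *: q) ** (M - 2^-1 *: q) + (K ** N) ** (K ** N)
      = 2^-1 *: (2^-1 *: q).
    have -> : (K ** N) ** (K ** N) = M - M ** M.
      by rewrite -smulA (smulA N) -KN -smulA NN smulA KK smulBr Mq.
    have -> : (M - 2^-1 *: q) ** (M - 2^-1 *: q)
      = M ** M - 2^-1 *: (M ** q) - 2^-1 *: (q ** M) + 4^-1 *: (q ** q) by nc.
    by rewrite Mq qM qq; nc.
  have := nrm_sqr_le_add (x := M - 2^-1 *: q) (y := K ** N).
  rewrite sh sKN => /(_ comm); rewrite sum !nrm_half.
  have := nrm_ge0 (M - 2^-1 *: q); nra.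
have prod : (M - S) ** (M + S) = 0.
  by rewrite smulDr !smulBl MMS SM; nc.
have [MS|MS] := eqVneq (M + S) 0.
  exists (- (nrm b / 2)).
  rewrite {1}bS.
  have -> : S = - M by apply/eqP; rewrite -addr_eq0 addrC MS.
  rewrite [X in nrm X](_ : _ = (nrm b)%:C *: - (M - 2^-1 *: q)).
    by rewrite nrmZ nrmN ger0_norm ?nrm_ge0// mulrC ler_wpM2r// nrm_ge0.
  by rewrite rmorphN rmorphM fmorphV rmorph_nat; nc.
have sMS : self_adjoint (M + S) by rewrite /self_adjoint starD sM sS.
have qMS : q ** (M + S) = M + S by rewrite smulDr qM qS.
have := nozd sMS MS qMS prod.
rewrite smulBl Mq Sq => /subr0_eq SE.
exists (nrm b / 2); rewrite {1}bS -SE.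
rewrite [X in nrm X](_ : _ = (nrm b)%:C *: (M - 2^-1 *: q)).
  by rewrite nrmZ ger0_norm ?nrm_ge0// mulrC ler_wpM2r// nrm_ge0.
by rewrite rmorphM fmorphV rmorph_nat; nc.
Qed.

(** Halving the distance repeatedly produces multiples of [q] that converge to
[b], with coefficients that form a Cauchy sequence. *)
Lemma corner_real b : self_adjoint b -> q ** b = b ->
  exists l : R, b = l%:C *: q.
Proof.
have [qq sq] := qP; move=> sb qb.
have q1 := projection_le1 qP.
have [q0|q0] := eqVneq q 0; first by exists 0; rewrite scale0r -qb q0 smul0l.
have nq : nrm q = 1.
  have := nrmSM q; rewrite sq qq => nq.
  by have := nrm_gt0 q0; nra.
have /choice[h hP] x : exists l : R, self_adjoint x -> q ** x = x ->
    nrm (x - l%:C *: q) <= 2^-1 * nrm x.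
  have [[sx qx]|nx] := pselect (self_adjoint x /\ q ** x = x).
    by have [l] := halve_distance sx qx; exists l.
  by exists 0 => sx qx; case: nx.
pose f x := x - (h x)%:C *: q.
pose u n := iter n f b.
have uP n : [/\ self_adjoint (u n), q ** u n = u n &
    nrm (u n) <= 2^-1 ^+ n * nrm b].
  elim: n => [|n [IH1 IH2 IH3]]; first by rewrite expr0 mul1r.
  split.
  - by rewrite /self_adjoint /= starB starZr sq IH1.
  - by rewrite /= smulBr smulZr qq IH2.
  - by rewrite (le_trans (hP _ IH1 IH2))// exprS -mulrA ler_wpM2l.
pose s n := \sum_(i < n) h (u i).
have us n : b - (s n)%:C *: q = u n.
  elim: n => [|n IH]; first by rewrite /s big_ord0 scale0r subr0.
  by rewrite /s big_ord_recr/= rmorphD scalerDl opprD addrA -/(s n) IH.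
pose d n := 3 * (2^-1 ^+ n * nrm b).
have d0 n : 0 <= d n by rewrite !mulr_ge0// ?exprn_ge0// nrm_ge0.
have sd n : `|s n.+1 - s n| <= d n - d n.+1.
  rewrite -[leLHS]mulr1 -nq -nrmZ rmorphB scalerBl.
  have -> : (s n.+1)%:C *: q - (s n)%:C *: q = u n - u n.+1 by rewrite -!us; nc.
  rewrite (le_trans (nrmD _ _))// nrmN.
  have [_ _ un] := uP n; have [_ _ un1] := uP n.+1.
  rewrite (le_trans (lerD un un1))// /d exprS; lra.
have [l lP] := nested_intervals d0 sd.
exists l; apply/subr0_eq/nrm_small_eq0 => e e0.
have c0 : 0 < 4 * nrm b + 1 by have := nrm_ge0 b; lra.
have [n ne] := half_expr_small (divr_gt0 e0 c0).
have -> : b - l%:C *: q = u n + (s n - l)%:C *: q.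
  by rewrite -us rmorphB; nc.
rewrite (le_trans (nrmD _ _))// nrmZ nq mulr1 distrC.
have [_ _ un] := uP n; rewrite (le_trans (lerD un (lP n)))//.
move: ne; rewrite ltr_pdivlMr// /d; have := nrm_ge0 b.
have : 0 <= (2^-1 : R) ^+ n by rewrite exprn_ge0.
nra.
Qed.

Lemma corner_complex a : exists c : R[i], q ** a ** q = c *: q.
Proof.
have [qq sq] := qP; set x := q ** a ** q.
have xs : x^*s = q ** a^*s ** q by rewrite /x !starM sq smulA.
have [|| l lE] := @corner_real (2^-1 *: (x + x^*s)).
- by rewrite /self_adjoint star_half starD starK addrC.
- by rewrite smulZr smulDr xs !smulA qq -/x.
have si : Num.conj (2^-1 * 'i : R[i]) = - (2^-1 * 'i).
  rewrite rmorphM fmorphV rmorph_nat -mulrN; congr (_ * _).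
  by apply/eqP; rewrite eq_complex/= !oppr0 !eqxx.
have [|| m mE] := @corner_real ((2^-1 * 'i) *: (x^*s - x)).
- by rewrite /self_adjoint starZ starB starK si scaleNr -scalerN opprB.
- by rewrite smulZr smulBr xs !smulA qq -/x.
exists (l%:C + 'i * m%:C); rewrite scalerDl -scalerA -lE -mE.
have ii : 'i * (2^-1 * 'i) = - 2^-1 :> R[i].
  by rewrite mulrCA -expr2 sqr_i mulrN1.
by rewrite scalerA ii; nc.
Qed.

End NoZeroDivisor.

(** A minimal projection that has no disjoint copy is central, and then
compression by it is a character. *)
Lemma minimal_infinite q : purely_infinite A -> is_projection q -> q != 0 ->
  (forall a, exists c : R[i], q ** a ** q = c *: q) ->
  exists s : A, infinite_projection s.
Proof.
move=> piA qP q0 qmin; have [qq sq] := qP.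
have inj (c d : R[i]) : c *: q = d *: q -> c = d.
  by move/eqP; rewrite -subr_eq0 -scalerBl scaler_eq0 (negPf q0) orbF subr_eq0 => /eqP.
have [central|] := pselect (forall a, a ** q = q ** a ** q); last first.
  move=> /existsNP[a /eqP]; rewrite -subr_eq0.
  set z0 := a ** q - q ** a ** q => z00.
  have qz0 : q ** z0 = 0 by rewrite /z0 smulBr !smulA qq subrr.
  have z0q : z0 ** q = z0 by rewrite /z0 smulBl -!smulA qq.
  clearbody z0.
  have qz0s : q ** z0^*s = z0^*s by have := congr1 (@star R A) z0q; rewrite starM sq.
  have [c cE] := qmin (z0^*s ** z0).
  rewrite smulA qz0s -smulA z0q in cE.
  have cr : Num.conj c = c.
    apply: inj; rewrite -cE -{1}sq -starZ -cE starM starK //.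
  have {cr} cE : z0^*s ** z0 = (complex.Re c)%:C *: q.
    by rewrite cE RRe_real//; apply/CrealP.
  set r := complex.Re c in cE.
  have scaled (t : R) : 0 < t -> (((Num.sqrt t)^-1%:C *: z0)^*s
      ** ((Num.sqrt t)^-1%:C *: z0)) = (r / t)%:C *: q.
    move=> t0; rewrite starZr smulZl smulZr scalerA cE scalerA; congr (_ *: _).
    rewrite -!rmorphM/=; congr (_%:C); rewrite -invfM -expr2 sqr_sqrtr ?ltW//.
    by rewrite mulrC.
  have [r0|r0|r0] := ltgtP r 0.
  (* [z* z = - q] is impossible: [h = z + z*] and the projection
  [g = q - z z*] would satisfy [h^2 + g^2 = 0]. *)
  - have r1 : 0 < - r by rewrite oppr_gt0.
    pose z := (Num.sqrt (- r))^-1%:C *: z0.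
    have zz : z^*s ** z = - q.
      rewrite /z scaled// invrN mulrN mulfV ?lt_eqF// rmorphN rmorph1.
      by rewrite scaleN1r.
    have qz : q ** z = 0 by rewrite /z smulZr qz0 scaler0.
    have zq : z ** q = z by rewrite /z smulZl z0q.
    clearbody z; have zsq : z^*s ** q = 0.
      by have := congr1 (@star R A) qz; rewrite starM sq star0.
    have qzs : q ** z^*s = z^*s.
      by have := congr1 (@star R A) zq; rewrite starM sq.
    have z2 : z ** z = 0 by rewrite -{1}zq -smulA qz smul0r.
    have zs2 : z^*s ** z^*s = 0 by rewrite -{2}qzs smulA zsq smul0l.
    pose g := q - z ** z^*s; pose h := z + z^*s.
    have hh : h ** h = - g.
      have -> : h ** h = z ** z + z ** z^*s + z^*s ** z + z^*s ** z^*s.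
        by rewrite /h; nc.
      by rewrite z2 zs2 zz /g; nc.
    have gg : g ** g = g.
      have -> : g ** g = q ** q - (q ** z) ** z^*s - z ** (z^*s ** q)
        + z ** (z^*s ** z) ** z^*s by rewrite /g; nc.
      by rewrite qq qz zsq zz /g smulNr smulNl zq smul0l smul0r; nc.
    have sg : g^*s = g by rewrite /g starB starM starK sq.
    have sh : h^*s = h by rewrite /h starD starK addrC.
    have gh : g ** h = h ** g.
      by apply: oppr_inj; rewrite -smulNl -smulNr -hh smulA.
    have := nrm_sqr_le_add (x := g) (y := h).
    rewrite sg sh gg hh subrr nrm0 => /(_ gh) g2.
    have g0 : g = 0.
      by apply: nrm_eq0; apply/eqP; rewrite -sqrf_eq0 eq_le g2 sqr_ge0.
    case/eqP: q0; rewrite -qq; move/subr0_eq: g0 => {2}->.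
    by rewrite smulA qz smul0l.
  - apply: (@disjoint_copy_infinite _ _ q ((Num.sqrt r)^-1%:C *: z0)) => //.
      by rewrite scaled// mulfV ?gt_eqF// scale1r.
    by rewrite smulZr qz0 scaler0.
  - by case/eqP: z00; apply: starM_eq0; rewrite cE r0 scale0r.
have central' a : q ** a = q ** a ** q.
  by have := congr1 (@star R A) (central a^*s); rewrite !starM starK sq smulA.
case: piA => nochar _; exfalso; apply: nochar.
have [chi chiE] := choice qmin.
exists chi; split.
- move=> k x y; apply: inj; rewrite -chiE scalerDl smulDr smulZr smulDl smulZl !chiE.
  by rewrite scalerA.
- move=> x y; apply: inj; rewrite -chiE -scalerA -(chiE y).
  by rewrite -smulZl -smulZl -chiE -(central' x) !smulA.
- exists q; suff -> : chi q = 1 by exact: oner_neq0.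
  by apply: inj; rewrite -chiE !qq scale1r.
Qed.

End Corner.

(** * Noetherian purely infinite algebras have infinite projections *)

Section Noetherian.
Context (R : realType) (A : cstarAlgType R).
Implicit Types (a b c e m p q x y z : A) (T : A * A * A).

Lemma self_adjointM0 x y : self_adjoint x -> self_adjoint y ->
  x ** y = 0 -> y ** x = 0.
Proof. by move=> sx sy /(congr1 (@star R A)); rewrite starM sx sy star0. Qed.

Lemma self_adjoint_absorb x y : self_adjoint x -> self_adjoint y ->
  x ** y = y -> y ** x = y.
Proof. by move=> sx sy /(congr1 (@star R A)); rewrite starM sx sy. Qed.

Lemma self_adjoint_sqr_eq0 x : self_adjoint x -> x ** x = 0 -> x = 0.
Proof. by move=> sx xx; apply: starM_eq0; rewrite sx. Qed.

Lemma not_in_ideal0 x : x != 0 -> ~ [set (0 : A)] x.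
Proof. by move=> /eqP. Qed.

(** The last clause transfers to the cut-offs every relation satisfied by [b];
it is applied to ideals, to annihilators and to solution sets of [e x = x]. *)
Lemma cutoff_functions (I : set A) b : closed_ideal I -> self_adjoint b -> ~ I b ->
  exists p : nat -> A,
    [/\ forall n, self_adjoint (p n) /\ nrm (p n) <= 1,
        forall n, p n ** p n.+1 = p n /\ p n.+1 ** p n = p n,
        ~ I (p 0%N) &
        forall V n, closed_subalgebra V -> V b -> V (p n)].
Proof.
move=> iI sb Ib; have b0 : b != 0 by apply/eqP => b0; apply: Ib; rewrite b0; exact: ideal0.
have n0 := nrm_gt0 b0.
pose k := (nrm b)^-1%:C; have k0 : k != 0.
  by rewrite /k fmorph_eq0 invr_eq0 gt_eqF.
have [|||p [pP pp Ip Vp]] := @cutoff_functions_contraction R A I (k *: b) iI.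
- by rewrite /self_adjoint starZr sb.
- by rewrite nrmZ ger0_norm ?invr_ge0 ?nrm_ge0// mulVf// gt_eqF.
- move=> Ikb; apply: Ib; rewrite -(scale1r b) -(mulVf k0) -scalerA.
  exact: csaZ (ideal_subalgebra iI) _ _ Ikb.
- by exists p; split=> // V n sV Vb; apply: Vp => //; exact: csaZ.
Qed.

Lemma chain_absorb (p : nat -> A) :
  (forall n, p n ** p n.+1 = p n /\ p n.+1 ** p n = p n) ->
  forall n k, p (n + k.+1)%N ** p n = p n /\ p n ** p (n + k.+1)%N = p n.
Proof.
move=> pp n; elim=> [|k [IH1 IH2]].
  by rewrite addn1; have [] := pp n.
rewrite addnS; have [h1 h2] := pp (n + k.+1)%N.
by split; [rewrite -{1}IH1 smulA h2 IH1|rewrite -{1}IH2 -smulA h1 IH2].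
Qed.

(** In the corner of [e0], [e] stays away from [c], with [m] as a witness; the
ideal of [e ** e] is to be made as large as possible. *)
Definition separated (e0 : A) T :=
  let: (e, m, c) := T in
  [/\ [/\ self_adjoint e, self_adjoint m & self_adjoint c],
      [/\ e0 ** e = e, e0 ** m = m & e0 ** c = c],
      m ** e = e, m ** c = 0 & c != 0].

Definition gen T : set A := ideal_of (T.1.1 ** T.1.1).

Lemma gen_sub T I : closed_ideal I -> I (T.1.1 ** T.1.1) -> gen T `<=` I.
Proof. exact: ideal_of_sub. Qed.

(** A noetherian algebra leaves no room for an ever growing separated
triple. *)
Lemma separated_full (e0 : A) : noetherian A ->
  (forall T, separated e0 T -> ~ gen T e0 ->
     exists T', [/\ separated e0 T', gen T `<=` gen T' & ~ gen T' `<=` gen T]) ->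
  forall T, separated e0 T -> exists T', separated e0 T' /\ gen T' e0.
Proof.
move=> nA grow T0 sT0; apply: contrapT => full.
have ngen T : separated e0 T -> ~ gen T e0.
  by move=> sT gT; apply: full; exists T.
have /choice[f fP] T : exists T', separated e0 T ->
    [/\ separated e0 T', gen T `<=` gen T' & ~ gen T' `<=` gen T].
  have [sT|nT] := pselect (separated e0 T); last by exists T.
  by have [T' T'P] := grow T sT (ngen T sT); exists T'.
have sf n : separated e0 (iter n f T0).
  by elim: n => [//|n IH]; have [] := fP _ IH.
have [||n /(_ n.+1 (leqnSn n)) nE] := nA (fun n => gen (iter n f T0)).
- by move=> n; exact: ideal_of_closed.
- by move=> n; have [] := fP _ (sf n).
- by have [_ _] := fP _ (sf n); apply; rewrite -[f _]/(iter n.+1 f T0) nE.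
Qed.

(** An element [b] that [m] kills and that lies in the ideal [gen T] allows a
replacement of [e] by the complement [e0 - p 2] of a cut-off of [b].  The new
ideal contains [e0] modulo [gen T], hence it contains more than [gen T]. *)
Lemma grow_in_ideal (e0 : A) T b : is_projection e0 -> separated e0 T ->
  ~ gen T e0 -> self_adjoint b -> b != 0 -> e0 ** b = b -> T.1.2 ** b = 0 ->
  gen T b ->
  exists T', [/\ separated e0 T', gen T `<=` gen T' & ~ gen T' `<=` gen T].
Proof.
case: T => [[e m] c] [ee se0] [[se sm sc] [e0e e0m e0c] me mc c0] ne0 sb b0 e0b.
move=> /= mb Ib; have [p [pP pp p0 Vp]] := cutoff_functions (@zero_ideal R A) sb (not_in_ideal0 b0).
have pV n : e0 ** p n = p n by exact: (Vp _ n (fixer_subalgebra e0) e0b).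
have mp n : m ** p n = 0 by exact: (Vp _ n (annihilator_subalgebra m) mb).
have iI := @ideal_of_closed _ _ (e ** e).
have sI := ideal_subalgebra iI.
have Ip n : ideal_of (e ** e) (p n) by exact: (Vp _ n sI Ib).
have sp n : self_adjoint (p n) by case: (pP n).
have pe0 n := self_adjoint_absorb se0 (sp n) (pV n).
have pn : p 0%N != 0 by apply/eqP.
have p20 : p 2 ** p 0%N = p 0%N by have [] := chain_absorb pp 0 1.
have p10 : p 1%N ** p 0%N = p 0%N by have [] := chain_absorb pp 0 0.
have [p21 p12] := chain_absorb pp 1 0.
have pe n : p n ** e = 0.
  by rewrite -me smulA (self_adjointM0 sm (sp n) (mp n)) smul0l.
pose f := e0 - p 2; have sf : self_adjoint f by rewrite /self_adjoint starB se0 sp.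
have fe : f ** e = e by rewrite smulBl e0e pe subr0.
exists (f, e0 - p 1%N, p 0%N); split.
- split=> //.
  + by split; rewrite // /self_adjoint starB se0 sp.
  + by split=> //; rewrite smulBr ee pV.
  + by rewrite smulBl !smulBr ee pV pe0 p12 subrr subr0.
  + by rewrite smulBl pV p10 subrr.
- apply: gen_sub; first exact: ideal_of_closed.
  have -> : ((e, m, c).1.1 ** e) = (f ** f) ** (e ** e).
    by rewrite -(smulA f f) (smulA f e e) fe smulA fe.
  exact: (idealMr _ (ideal_of_closed (f ** f)) (ideal_of_self (f ** f))).
- move=> /(_ _ (ideal_of_self (f ** f))); rewrite /gen/= => If.
  apply: ne0; rewrite /gen/=.
  have -> : e0 = f ** f + p 2 + p 2 - p 2 ** p 2.
    by rewrite /f !(smulBl, smulBr) ee pV pe0; nc.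
  exact: (csaB sI (csaD sI (csaD sI If (Ip 2)) (Ip 2)) (csaM sI (Ip 2) (Ip 2))).
Qed.

(** If [m] kills [b], a cut-off of [b] can be added to [e].  The exception is
when the cut-offs of [b] stop at a projection. *)
Lemma grow_outside_ideal (e0 : A) T b : is_projection e0 -> separated e0 T ->
  self_adjoint b -> b != 0 -> e0 ** b = b -> T.1.2 ** b = 0 ->
  (forall x, self_adjoint x -> x != 0 -> e0 ** x = x -> T.1.2 ** x = 0 ->
     ~ gen T x) ->
  (exists T', [/\ separated e0 T', gen T `<=` gen T' & ~ gen T' `<=` gen T]) \/
  exists q, [/\ is_projection q, q != 0 &
    forall V, closed_subalgebra V -> V b -> V q].
Proof.
case: T => [[e m] c] [ee se0] [[se sm sc] [e0e e0m e0c] me mc c0] sb b0 e0b.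
move=> /= mb out; have [p [pP pp p0 Vp]] := cutoff_functions (@zero_ideal R A) sb (not_in_ideal0 b0).
have pV n : e0 ** p n = p n by exact: (Vp _ n (fixer_subalgebra e0) e0b).
have mp n : m ** p n = 0 by exact: (Vp _ n (annihilator_subalgebra m) mb).
have sp n : self_adjoint (p n) by case: (pP n).
have pm n := self_adjointM0 sm (sp n) (mp n).
have pn : p 0%N != 0 by apply/eqP.
have [p10 p01] := pp 0%N.
have [p20 _] := chain_absorb pp 0 1.
have [p31 p13] := chain_absorb pp 1 1.
have [p21 p12] := chain_absorb pp 1 0.
have [p32 p23] := chain_absorb pp 2 0.
have pe n : p n ** e = 0 by rewrite -me smulA pm smul0l.
have ep n : e ** p n = 0.
  by have := congr1 (@star R A) (pe n); rewrite starM se sp star0.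
have [p3E|p3E] := eqVneq (p 3) (p 2).
  right; exists (p 2); split.
  - by split; [rewrite -{1}p3E; exact: p32|exact: sp].
  - by apply: contra_neq pn => p2E; rewrite -p20 p2E smul0l.
  - by move=> V sV Vb; exact: Vp.
left; pose f := e + p 0%N.
have ff : f ** f = e ** e + p 0%N ** p 0%N.
  by rewrite /f !(smulDl, smulDr) pe ep; nc.
have mff : m ** (f ** f) = e ** e by rewrite ff smulDr !smulA me mp smul0l addr0.
have IE := ideal_of_closed (f ** f).
have Iee : ideal_of (f ** f) (e ** e).
  by rewrite -mff; exact: (idealMl _ IE (ideal_of_self _)).
exists (f, m + p 1%N, p 3 - p 2); split.
- split=> //.
  + by split; rewrite /self_adjoint ?starD ?starN ?se ?sm ?sp.
  + by split; rewrite ?smulBr ?smulDr ?e0e ?e0m ?pV.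
  + by rewrite /f !(smulDl, smulDr) me mp pe p01; nc.
  + by rewrite !(smulDl, smulBr) !mp p13 p12; nc.
  + by rewrite subr_eq0.
- exact: gen_sub.
- move=> sub; apply: (out (p 0%N ** p 0%N)).
  + by rewrite /self_adjoint starM sp.
  + by apply: contra_neq pn; exact: self_adjoint_sqr_eq0.
  + by rewrite smulA pV.
  + by rewrite smulA mp smul0l.
  + apply: sub; rewrite /gen/=.
    have := csaB (ideal_subalgebra IE) (ideal_of_self (f ** f)) Iee.
    by rewrite {2}ff [e ** e + _]addrC addrK.
Qed.

(** For a triple with maximal ideal not containing [e0], both ways of growing
fail; the cut-offs of [c] then stop at a projection [q] killed by [m], and the
cut-offs of any [b] in the corner of [q] stop at [q] itself, for otherwise [q]
would split and the triple would grow. *)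
Lemma projection_infinite (e0 : A) : purely_infinite A -> noetherian A ->
  is_projection e0 -> e0 != 0 -> exists s : A, infinite_projection s.
Proof.
move=> piA nA e0P e00; apply: contrapT => noinf; have [ee se0] := e0P.
have sep0 : separated e0 (0, 0, e0).
  by split; rewrite ?smul0l ?smul0r//; split; rewrite /self_adjoint ?star0 ?smul0r.
have [|[[e m] c] [[[se sm sc] [e0e e0m e0c] me mc c0] fullT]] :=
  separated_full nA _ sep0; last first.
  apply: noinf; apply: (@compression_infinite _ _ e m c e0) => //.
  - exact: projection_le1.
  - exact: self_adjointM0 mc.
  - by rewrite ee.
move=> T sT ne0; apply: contrapT => nogrow.
have out x : self_adjoint x -> x != 0 -> e0 ** x = x -> T.1.2 ** x = 0 ->
    ~ gen T x.
  by move=> sx x0 ex mx Ix; apply: nogrow; exact: (grow_in_ideal e0P sT ne0 sx).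
have [q [qP q0 e0q mq]] : exists q, [/\ is_projection q, q != 0, e0 ** q = q &
    T.1.2 ** q = 0].
  case: T {ne0} sT nogrow out => [[e m] c] sT nogrow out.
  have [[_ _ sc] [_ _ e0c] _ mc c0] := sT.
  have [//|[q [qP q0 Vq]]] := grow_outside_ideal e0P sT sc c0 e0c mc out.
  exists q; split=> //; first exact: (Vq _ (fixer_subalgebra e0) e0c).
  exact: (Vq _ (annihilator_subalgebra m) mc).
have [qq sq] := qP.
have sub x : q ** x = x -> e0 ** x = x /\ T.1.2 ** x = 0.
  by move=> <-; rewrite !smulA e0q mq smul0l.
apply: noinf; apply: (minimal_infinite piA qP q0).
move=> a; apply: (corner_complex qP) => b z sb b0 qb zb.
have [e0b mb] := sub b qb.
have [//|[p [pP p0 Vp]]] := grow_outside_ideal e0P sT sb b0 e0b mb out.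
have zp : z ** p = 0 by exact: (Vp _ (annihilator_subalgebra z) zb).
have qp : q ** p = p by exact: (Vp _ (fixer_subalgebra q) qb).
have [<-//|pq] := eqVneq p q; exfalso; apply: nogrow.
have [e0p mp] := sub p qp.
case: T {ne0} sT mq out sub mb mp => [[e m] c].
case=> [[se sm sc] [e0e e0m e0c] me mc c0] /= mq out sub mb mp.
have [pp sp] := pP.
have pe : p ** e = 0 by rewrite -me smulA (self_adjointM0 sm sp mp) smul0l.
have ep : e ** p = 0 by exact: self_adjointM0 pe.
have ff : (e + p) ** (e + p) = e ** e + p.
  by rewrite !(smulDl, smulDr) pe ep pp; nc.
have IE := ideal_of_closed ((e + p) ** (e + p)).
have Iee : ideal_of ((e + p) ** (e + p)) (e ** e).
  have <- : m ** ((e + p) ** (e + p)) = e ** e by rewrite ff smulDr smulA me mp addr0.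
  exact: (idealMl _ IE (ideal_of_self _)).
exists (e + p, m + p, q - p); split.
- split=> //.
  + by split; rewrite /self_adjoint ?starD ?starN ?se ?sm ?sp ?sq.
  + by split; rewrite ?smulBr ?smulDr ?e0e ?e0m ?e0p ?e0q.
  + by rewrite !(smulDl, smulDr) me mp pe pp; nc.
  + rewrite !(smulDl, smulBr) mq mp pp (self_adjoint_absorb sq sp qp); nc.
  + by rewrite subr_eq0 eq_sym.
- exact: gen_sub.
- move=> gsub; apply: (out p) => //; apply: gsub; rewrite /gen/=.
  have := csaB (ideal_subalgebra IE) (ideal_of_self ((e + p) ** (e + p))) Iee.
  by rewrite {2}ff [e ** e + p]addrC addrK.
Qed.

(** The chain condition is applied to the ideals of [p n ** p n]; far enough,
[p (n + 4)] is compressed into the corner of [p n], and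
[p (n + 3) - p (n + 2)] is left out. *)
Lemma noetherian_infinite_projection : nonzero_alg A -> noetherian A ->
  purely_infinite A -> exists s : A, infinite_projection s.
Proof.
move=> [a a0] nA piA.
pose b := a^*s ** a; have sb : self_adjoint b by rewrite /self_adjoint starM starK.
have b0 : b != 0 by apply: contra_neq a0; exact: starM_eq0.
have [p [pP pp p0 _]] := cutoff_functions (@zero_ideal R A) sb (not_in_ideal0 b0).
have sp n : self_adjoint (p n) by case: (pP n).
have [|n nE] := nA (fun n => ideal_of (p n ** p n)) (fun n => ideal_of_closed _).
  move=> n; apply: ideal_of_sub; first exact: ideal_of_closed.
  have -> : p n ** p n = (p n.+1 ** p n.+1) ** (p n ** p n).
    by have [_ h] := pp n; rewrite -(smulA (p n.+1)) (smulA _ (p n)) h smulA h.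
  exact: (idealMr _ (ideal_of_closed (p n.+1 ** p n.+1)) (ideal_of_self _)).
have [h1 h1'] := chain_absorb pp n 0.
have [h2 h2'] := chain_absorb pp n 1.
have [h4 h4'] := chain_absorb pp n 3.
have [h12 h12'] := chain_absorb pp (n + 1) 0.
have [h13 h13'] := chain_absorb pp (n + 1) 1.
have [h14 h14'] := chain_absorb pp (n + 1) 2.
have [h23 h23'] := chain_absorb pp (n + 2) 0.
have [h24 h24'] := chain_absorb pp (n + 2) 1.
have [h34 h34'] := chain_absorb pp (n + 3) 0.
rewrite -!addnA in h12 h12' h13 h13' h14 h14' h23 h23' h24 h24' h34 h34'.
have [p3E|p3E] := eqVneq (p (n + 3)%N) (p (n + 2)%N).
  apply: (@projection_infinite (p (n + 2)%N)) => //.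
    by split; [rewrite -{1}p3E|exact: sp].
  apply/eqP => p2E; apply: p0; rewrite /set1/=.
  have [h _] := chain_absorb pp 0 (n + 1).
  by rewrite add0n -addnS in h; rewrite -h p2E smul0l.
apply: (@compression_infinite _ _ (p n) (p (n + 1)%N)
  (p (n + 3)%N - p (n + 2)%N) (p (n + 4)%N)) => //.
- by rewrite /self_adjoint starB !sp.
- by have [] := pP (n + 4)%N.
- by rewrite smulBl h13 h12 subrr.
- by rewrite subr_eq0.
- by rewrite smulBr h34 h24.
- by rewrite -(nE (n + 4)%N (leq_addr _ _)); exact: ideal_of_self.
Qed.

End Noetherian.

(** * Homomorphisms and almost idempotent elements *)

Section Homs.
Context (R : realType).

Section Linear.
Context (A B : starAlgType R) (f : A -> B) (fH : is_star_hom f).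

Lemma homM x y : f (x ** y) = f x ** f y. Proof. by case: fH => _ /(_ x y). Qed.

Lemma hom_star x : f x^*s = (f x)^*s. Proof. by case: fH => _ _ /(_ x). Qed.

Lemma homD x y : f (x + y) = f x + f y.
Proof. by case: fH => /(_ 1 x y); rewrite !scale1r. Qed.

Lemma hom0 : f 0 = 0.
Proof. by apply: (addrI (f 0)); rewrite -homD !addr0. Qed.

Lemma homZ c x : f (c *: x) = c *: f x.
Proof. by case: fH => /(_ c x 0); rewrite hom0 !addr0. Qed.

Lemma homN x : f (- x) = - f x.
Proof. by rewrite -scaleN1r homZ scaleN1r. Qed.

Lemma homB x y : f (x - y) = f x - f y.
Proof. by rewrite homD homN. Qed.

End Linear.

Lemma star_hom_id (A : starAlgType R) : is_star_hom (fun x : A => x).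
Proof. by []. Qed.

Lemma star_hom_comp (A B C : starAlgType R) (f : A -> B) (g : B -> C) :
  is_star_hom f -> is_star_hom g -> is_star_hom (fun x => g (f x)).
Proof.
move=> fH gH; split.
- by move=> c x y; rewrite (homD fH) (homZ fH) (homD gH) (homZ gH).
- by move=> x y; rewrite (homM fH) (homM gH).
- by move=> x; rewrite (hom_star fH) (hom_star gH).
Qed.

(** A homomorphism maps a point of the unit circle to a point of the unit
circle, so it is contractive on self-adjoint elements. *)
Lemma star_hom_contractive (A B : cstarAlgType R) (f : A -> B) :
  is_star_hom f -> forall x, nrm (f x) <= nrm x.
Proof.
move=> fH.
have unit x : self_adjoint x -> nrm x <= 1 -> nrm (f x) <= 1.
  move=> sx x1; have xx1 : nrm (x ** x) <= 1.
    by rewrite -{1}sx nrmSM expr_le1// nrm_ge0.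
  have [w [wE _ Vw sw]] := half_root xx1.
  have sfx : self_adjoint (f x) by rewrite /self_adjoint -(hom_star fH) sx.
  apply: nrm_le1_mul => //.
  have [||||_] // := @circle_contraction R B (f w) (f x) (f x).
  - by rewrite /self_adjoint -(hom_star fH) sw// starM sx.
  - by rewrite -!(homM fH) (csa_commute Vw)// smulA.
  - by rewrite -!(homM fH) -(homD fH) -(homB fH) wE.
have sa x : self_adjoint x -> nrm (f x) <= nrm x.
  move=> sx; have [->|x0] := eqVneq x 0; first by rewrite (hom0 fH) !nrm0.
  have n0 := nrm_gt0 x0.
  have := unit ((nrm x)^-1%:C *: x).
  rewrite /self_adjoint starZr sx (homZ fH) !nrmZ ger0_norm ?invr_ge0 ?nrm_ge0//.
  rewrite mulVf ?gt_eqF// => /(_ erefl (lexx _)).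
  by rewrite mulrC ler_pdivrMr// mul1r.
move=> x; rewrite -(@ler_pXn2r _ 2) ?nnegrE ?nrm_ge0//.
by rewrite -!nrmSM -(hom_star fH) -(homM fH) sa// /self_adjoint starM starK.
Qed.

(** Replacing [2 z - 1] by [(2 z - 1) ((2 z - 1)^2)^(-1/2)] turns an element
that is almost idempotent into an idempotent nearby. *)
Lemma near_idempotent (A : cstarAlgType R) (z : A) :
  (forall p : A, p ** p = p -> p = 0) -> nrm (z ** z - z) <= 16^-1 ->
  nrm z <= 8 * nrm (z ** z - z).
Proof.
move=> noid z1; pose d := 4%:C *: (z ** z - z).
have dE : nrm d = 4 * nrm (z ** z - z) by rewrite nrmZ ger0_norm.
have d1 : nrm d <= 2^-1 by rewrite dE; lra.
have [g [gE g1 Vg _]] := inverse_root d1.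
have zg : z ** g = g ** z.
  by apply: (csa_commute Vg); rewrite /d smulZr smulZl smulBr smulBl smulA.
have p0 : z - z ** g + 2^-1 *: g = 0.
  apply: noid.
  transitivity ((z - g ** z + 2^-1 *: g) ** (z - z ** g + 2^-1 *: g)).
    by rewrite zg.
  have d4 : d = 4 *: (z ** z - z) by rewrite /d -[4]/(4%:R) rmorph_nat.
  transitivity (z - z ** g + 2^-1 *: g
    + 4^-1 *: ((d - g ** d - d ** g + g ** g + g ** d ** g) - (g + g))
    + 2^-1 *: (z ** g - g ** z)); last by rewrite -gE zg !subrr !scaler0 !addr0.
  by rewrite d4; nc.
have zE : z = z ** g - 2^-1 *: g by rewrite -[LHS]subr0 -p0; nc.
have : nrm z <= nrm z * nrm g + 2^-1 * nrm g.
  by rewrite {1}zE (le_trans (nrmD _ _))// nrmN nrm_half lerD// nrmM.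
have := nrm_ge0 z; have := nrm_ge0 g; nra.
Qed.

End Homs.

(** * The limit of a direct system *)

(** Bundled so that the type of the limit can carry canonical instances. *)
Record direct_system (R : realType) := DirectSystem {
  obj : nat -> cstarAlgType R;
  map_next : forall n, obj n -> obj n.+1;
  map_hom : forall n, is_star_hom (@map_next n)
}.

Section Families.
Context (R : realType) (D : direct_system R).
Local Notation B := (obj D).
Local Notation phi := (@map_next _ D).

Definition family := forall n, B n.
Implicit Types x y z : family.

Fixpoint trans n k : B n -> B (k + n)%N :=
  match k with 0%N => id | k.+1 => fun b => phi (trans k b) end.

Lemma trans_hom n k : is_star_hom (@trans n k).
Proof.
elim: k => [|k IH]; first exact: star_hom_id.
exact: (star_hom_comp IH (@map_hom _ D _)).
Qed.

Lemma trans_le n k (b : B n) : nrm (trans k b) <= nrm b.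
Proof. exact: star_hom_contractive (@trans_hom n k) b. Qed.

Definition coherent x := forall e : R, 0 < e ->
  \forall n \near \oo, forall k, nrm (x (k + n)%N - trans k (x n)) <= e.

Definition null x := forall e : R, 0 < e -> \forall n \near \oo, nrm (x n) <= e.

Definition addf x y : family := fun n => x n + y n.
Definition oppf x : family := fun n => - x n.
Definition zerof : family := fun n => 0.
Definition scalef (c : R[i]) x : family := fun n => c *: x n.
Definition mulf x y : family := fun n => x n ** y n.
Definition starf x : family := fun n => (x n)^*s.
Definition subf x y : family := addf x (oppf y).

Lemma nullD x y : null x -> null y -> null (addf x y).
Proof.
move=> nx ny e e0; have e2 : 0 < e / 2 by rewrite divr_gt0.
apply: filterS2 (nx _ e2) (ny _ e2) => n h1 h2.
by rewrite (le_trans (nrmD _ _))// (splitr e) lerD.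
Qed.

Lemma null0 : null zerof.
Proof. by move=> e e0; apply: nearW => n; rewrite /zerof nrm0 ltW. Qed.

Lemma nullN x : null x -> null (oppf x).
Proof. by move=> nx e e0; apply: filterS (nx e e0) => n; rewrite /oppf nrmN. Qed.

Lemma null_ext x y : (forall n, x n = y n) -> null x -> null y.
Proof. by move=> xy nx e e0; apply: filterS (nx e e0) => n; rewrite xy. Qed.

Lemma null_swap x y : null (subf x y) -> null (subf y x).
Proof.
move=> /nullN; apply: null_ext => n.
by rewrite /oppf /subf /addf /oppf opprB.
Qed.

Lemma null_star x : null x -> null (starf x).
Proof. by move=> nx e e0; apply: filterS (nx e e0) => n; rewrite /starf nrm_star. Qed.

Lemma normc_ge0 (c : R[i]) : `|c| = (complex.Re `|c|)%:C.
Proof. by rewrite RRe_real// ger0_real. Qed.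

Lemma nrmZ_Re (V : normedModType R[i]) (c : R[i]) (v : V) :
  nrm (c *: v) = complex.Re `|c| * nrm v.
Proof. by apply: (@complexI R); rewrite nrmZc rmorphM/= -normc_ge0. Qed.

Lemma Re_norm_ge0 (c : R[i]) : 0 <= complex.Re `|c|.
Proof. by rewrite -lecR -normc_ge0 normr_ge0. Qed.

Lemma nullM_bounded (M : R) x y : 0 <= M -> (\forall n \near \oo, nrm (x n) <= M) ->
  null y -> null (mulf x y) /\ null (mulf y x).
Proof.
move=> M0 xM ny.
have small e : 0 < e -> \forall n \near \oo, nrm (x n) * nrm (y n) <= e.
  move=> e0; have M1 : 0 < M + 1 by rewrite ltr_wpDl.
  have e1 : 0 < e / (M + 1) by rewrite divr_gt0.
  apply: filterS2 xM (ny _ e1) => n h1 h2.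
  rewrite (le_trans (ler_pM (nrm_ge0 _) (nrm_ge0 _) h1 h2))//.
  rewrite mulrCA ger_pMr// ler_pdivrMr// mul1r; lra.
split=> e e0; apply: filterS (small e e0) => n; apply: le_trans.
  exact: nrmM.
by rewrite mulrC; exact: nrmM.
Qed.

Lemma nullZ c x : null x -> null (scalef c x).
Proof.
move=> nx e e0; have c1 : 0 < complex.Re `|c| + 1 by rewrite ltr_wpDl// Re_norm_ge0.
have e1 : 0 < e / (complex.Re `|c| + 1) by rewrite divr_gt0.
apply: filterS (nx _ e1) => n h.
rewrite /scalef nrmZ_Re (le_trans (ler_wpM2l (Re_norm_ge0 c) h))//.
rewrite mulrCA ger_pMr// ler_pdivrMr// mul1r; lra.
Qed.

Lemma coherent_bounded x : coherent x ->
  exists2 M : R, 0 <= M & \forall n \near \oo, nrm (x n) <= M.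
Proof.
move=> /(_ 1 ltr01)[N _ /(_ N (leqnn N)) /= xN].
exists (1 + nrm (x N)); first by rewrite addr_ge0// nrm_ge0.
exists N => // n /= Nn; rewrite -(subnK Nn).
rewrite -(subrK (trans (n - N) (x N)) (x _)) (le_trans (nrmD _ _))// lerD//.
exact: trans_le.
Qed.

Lemma coherentD x y : coherent x -> coherent y -> coherent (addf x y).
Proof.
move=> cx cy e e0; have e2 : 0 < e / 2 by rewrite divr_gt0.
apply: filterS2 (cx _ e2) (cy _ e2) => n h1 h2 k.
rewrite /addf (homD (trans_hom n k)) opprD addrACA.
by rewrite (le_trans (nrmD _ _))// (splitr e) lerD.
Qed.

Lemma coherentZ c x : coherent x -> coherent (scalef c x).
Proof.
move=> cx e e0; have c1 : 0 < complex.Re `|c| + 1 by rewrite ltr_wpDl// Re_norm_ge0.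
have e1 : 0 < e / (complex.Re `|c| + 1) by rewrite divr_gt0.
apply: filterS (cx _ e1) => n h k.
rewrite /scalef (homZ (trans_hom n k)) -scalerBr nrmZ_Re.
rewrite (le_trans (ler_wpM2l (Re_norm_ge0 c) (h k)))//.
rewrite mulrCA ger_pMr// ler_pdivrMr// mul1r; lra.
Qed.

Lemma coherentN x : coherent x -> coherent (oppf x).
Proof.
move=> cx e e0; apply: filterS (cx e e0) => n h k.
by rewrite /oppf (homN (trans_hom n k)) -opprD nrmN.
Qed.

Lemma coherent0 : coherent zerof.
Proof.
move=> e e0; apply: nearW => n k.
by rewrite /zerof (hom0 (trans_hom n k)) subrr nrm0 ltW.
Qed.

Lemma coherent_star x : coherent x -> coherent (starf x).
Proof.
move=> cx e e0; apply: filterS (cx e e0) => n h k.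
by rewrite /starf (hom_star (trans_hom n k)) -starB nrm_star.
Qed.

Lemma near_shift (P : nat -> Prop) : (\forall n \near \oo, P n) ->
  \forall n \near \oo, forall k, P (k + n)%N.
Proof.
by move=> [N _ PN]; exists N => // n /= Nn k; apply: PN; rewrite /= (leq_trans Nn)// leq_addl.
Qed.

Lemma coherentM x y : coherent x -> coherent y -> coherent (mulf x y).
Proof.
move=> cx cy e e0.
have [M M0 xM] := coherent_bounded cx; have [N N0 yN] := coherent_bounded cy.
have K0 : 0 < M + N + 1 by rewrite ltr_wpDl// addr_ge0.
have e1 : 0 < e / (M + N + 1) by rewrite divr_gt0.
apply: filterS (filterI (filterI (near_shift xM) yN)
  (filterI (cx _ e1) (cy _ e1))) => n [[hx hy] [h1 h2]] k.
rewrite /mulf (homM (trans_hom n k)).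
have -> : x (k + n)%N ** y (k + n)%N - trans k (x n) ** trans k (y n)
  = x (k + n)%N ** (y (k + n)%N - trans k (y n))
    + (x (k + n)%N - trans k (x n)) ** trans k (y n) by nc.
rewrite (le_trans (nrmD _ _))//.
rewrite (@le_trans _ _ (M * (e / (M + N + 1)) + e / (M + N + 1) * N))//.
  apply: lerD; rewrite (le_trans (nrmM _ _))// ler_pM// ?nrm_ge0//.
  exact: le_trans (trans_le _ _) hy.
rewrite [X in _ + X]mulrC -mulrDl mulrCA ger_pMr// ler_pdivrMr// mul1r; lra.
Qed.

(** The limit superior of the norms of the members of a family. *)
Definition limnorm x : R :=
  inf [set M | 0 <= M /\ \forall n \near \oo, nrm (x n) <= M].

Lemma limnorm_le x (M : R) : 0 <= M -> (\forall n \near \oo, nrm (x n) <= M) ->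
  limnorm x <= M.
Proof.
move=> M0 xM; apply: ge_inf; last by split.
by exists 0 => ? [].
Qed.

Lemma limnorm_ge0 x : 0 <= limnorm x.
Proof.
rewrite /limnorm; set S := [set M | _].
have [->|/set0P Sn] := eqVneq S set0; first by rewrite inf0.
by apply: lb_le_inf => // M [].
Qed.

Lemma near_limnorm x (e : R) : coherent x -> 0 < e ->
  \forall n \near \oo, nrm (x n) <= limnorm x + e.
Proof.
move=> cx e0; have [M M0 xM] := coherent_bounded cx.
have hi : has_inf [set M | 0 <= M /\ \forall n \near \oo, nrm (x n) <= M].
  by split; [exists M|exists 0 => ? []].
have [K [K0 xK] Ke] := inf_adherent e0 hi.
by apply: filterS xK => n /le_trans; apply; exact: ltW.
Qed.

Lemma limnorm_null x y : coherent x -> coherent y -> null (subf x y) ->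
  limnorm x <= limnorm y.
Proof.
move=> cx cy nxy; apply/ler_addgt0Pr => e e0.
have e2 : 0 < e / 2 by rewrite divr_gt0.
apply: limnorm_le; first by rewrite addr_ge0// ?limnorm_ge0// ltW.
apply: filterS2 (near_limnorm cy e2) (nxy _ e2) => n h1 h2.
have -> : x n = y n + (x n - y n) by rewrite addrC subrK.
rewrite (le_trans (nrmD _ _))// (splitr e) addrA lerD//.
Qed.

Lemma limnorm_eq0 x : coherent x -> limnorm x = 0 -> null x.
Proof.
by move=> cx x0 e e0; have := near_limnorm cx e0; rewrite x0 add0r.
Qed.

Lemma limnormD x y : coherent x -> coherent y ->
  limnorm (addf x y) <= limnorm x + limnorm y.
Proof.
move=> cx cy; apply/ler_addgt0Pr => e e0.
have e2 : 0 < e / 2 by rewrite divr_gt0.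
apply: limnorm_le; first by rewrite !addr_ge0// ?limnorm_ge0// ltW.
apply: filterS2 (near_limnorm cx e2) (near_limnorm cy e2) => n h1 h2.
rewrite (le_trans (nrmD _ _))// (le_trans (lerD h1 h2))//; lra.
Qed.

Lemma limnormZ_le c x : coherent x ->
  limnorm (scalef c x) <= complex.Re `|c| * limnorm x.
Proof.
move=> cx; apply/ler_addgt0Pr => e e0.
have c1 : 0 < complex.Re `|c| + 1 by rewrite ltr_wpDl// Re_norm_ge0.
have e1 : 0 < e / (complex.Re `|c| + 1) by rewrite divr_gt0.
apply: limnorm_le.
  by rewrite addr_ge0// ?mulr_ge0 ?Re_norm_ge0 ?limnorm_ge0// ltW.
apply: filterS (near_limnorm cx e1) => n h.
rewrite /scalef nrmZ_Re (le_trans (ler_wpM2l (Re_norm_ge0 c) h))//.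
rewrite mulrDr lerD2l mulrCA ger_pMr// ler_pdivrMr// mul1r; lra.
Qed.

Lemma limnormZ c x : coherent x ->
  limnorm (scalef c x) = complex.Re `|c| * limnorm x.
Proof.
move=> cx; apply/le_anti; rewrite limnormZ_le//.
have [->|c0] := eqVneq c 0; first by rewrite normr0 mul0r limnorm_ge0.
have cc : 0 < complex.Re `|c| by rewrite -ltcR -normc_ge0 normr_gt0.
rewrite -ler_pdivlMl//.
have := limnormZ_le c^-1 (coherentZ c cx).
have -> : scalef c^-1 (scalef c x) = x.
  by apply: functional_extensionality_dep => n; rewrite /scalef scalerA mulVf// scale1r.
suff -> : complex.Re `|c^-1| = (complex.Re `|c|)^-1 by [].
by rewrite normfV {1}(normc_ge0 c) -fmorphV.
Qed.

Lemma limnormM x y : coherent x -> coherent y ->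
  limnorm (mulf x y) <= limnorm x * limnorm y.
Proof.
move=> cx cy; apply/ler_addgt0Pr => e e0.
set a := limnorm x; set b := limnorm y.
have a0 : 0 <= a by exact: limnorm_ge0.
have b0 : 0 <= b by exact: limnorm_ge0.
have K0 : 0 < a + b + 1 + e by lra.
pose d := e / (a + b + 1 + e).
have d0 : 0 < d by rewrite divr_gt0.
have d1 : d <= 1 by rewrite ler_pdivrMr// mul1r; lra.
have dE : d * (a + b + 1 + e) = e by rewrite divfK// gt_eqF.
apply: limnorm_le; first by rewrite addr_ge0 ?mulr_ge0// ltW.
apply: filterS2 (near_limnorm cx d0) (near_limnorm cy d0) => n h1 h2.
rewrite (le_trans (nrmM _ _))// (le_trans (ler_pM (nrm_ge0 _) (nrm_ge0 _) h1 h2))//.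
rewrite -/a -/b; nra.
Qed.

Lemma limnorm_star x : coherent x -> limnorm (starf x) <= limnorm x.
Proof.
move=> cx; apply/ler_addgt0Pr => e e0.
apply: limnorm_le; first by rewrite addr_ge0// ?limnorm_ge0// ltW.
by apply: filterS (near_limnorm cx e0) => n; rewrite /starf nrm_star.
Qed.

Lemma limnormSM x : coherent x ->
  limnorm (mulf (starf x) x) = limnorm x ^+ 2.
Proof.
move=> cx; have csx := coherent_star cx; have cm := coherentM csx cx.
apply/le_anti/andP; split.
  rewrite (le_trans (limnormM csx cx))// expr2 ler_wpM2r ?limnorm_ge0//.
  exact: limnorm_star.
apply/ler_addgt0Pr => e e0.
have s0 : 0 <= limnorm (mulf (starf x) x) + e by rewrite addr_ge0 ?limnorm_ge0// ltW.
rewrite -(sqr_sqrtr s0) ler_pXn2r ?nnegrE ?limnorm_ge0 ?sqrtr_ge0//.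
apply: limnorm_le; first exact: sqrtr_ge0.
apply: filterS (near_limnorm cm e0) => n; rewrite /mulf /starf nrmSM => h.
by rewrite -(ger0_norm (nrm_ge0 (x n))) -sqrtr_sqr ler_wsqrtr.
Qed.

End Families.

(** The inductive limit: coherent families modulo null families, as sets of
families. *)
Definition limit_alg (R : realType) (D : direct_system R) : Type :=
  {S : set (family D) |
    exists2 x, coherent x & S = [set y | null (subf y x)]}.

Section Limit.
Context (R : realType) (D : direct_system R).
Local Notation L := (limit_alg D).
Local Notation dfunext := functional_extensionality_dep.
Implicit Types (x y z : family D) (a b c : L).

Definition cls x (cx : coherent x) : L := exist _ _ (ex_intro2 _ _ x cx erefl).

Definition rep c : family D := s2val (cid2 (proj2_sig c)).

Lemma rep_coherent c : coherent (rep c).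
Proof. exact: (s2valP (cid2 (proj2_sig c))). Qed.

Lemma null_sub_self x : null (subf x x).
Proof.
by apply: null_ext (null0 D) => n; rewrite /subf /addf /oppf subrr.
Qed.

Lemma cls_eq x y (cx : coherent x) (cy : coherent y) :
  null (subf x y) -> cls cx = cls cy.
Proof.
move=> nxy; apply: eq_exist; apply/seteqP; split=> z /= nz.
  apply: null_ext (nullD nz nxy) => n.
  by rewrite /subf /addf /oppf addrA subrK.
apply: null_ext (nullD nz (nullN nxy)) => n.
by rewrite /subf /addf /oppf opprB addrA subrK.
Qed.

Lemma cls_null x y (cx : coherent x) (cy : coherent y) :
  cls cx = cls cy -> null (subf x y).
Proof.
move=> /(congr1 sval)/= /seteqP[xy _].
exact: (xy x (null_sub_self x)).
Qed.

Lemma rep_cls c : c = cls (rep_coherent c).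
Proof.
case: c => S Sx; rewrite /cls; apply: eq_exist.
exact: (s2valP' (cid2 Sx)).
Qed.

Lemma null_rep x (cx : coherent x) : null (subf (rep (cls cx)) x).
Proof. by apply: (@cls_null _ _ (rep_coherent _)); rewrite -rep_cls. Qed.

HB.instance Definition _ := gen_eqMixin L.
HB.instance Definition _ := gen_choiceMixin L.

Definition lim_zero : L := cls (coherent0 D).
Definition lim_opp a : L := cls (coherentN (rep_coherent a)).
Definition lim_add a b : L := cls (coherentD (rep_coherent a) (rep_coherent b)).
Definition lim_scale (k : R[i]) a : L := cls (coherentZ k (rep_coherent a)).
Definition lim_smul a b : L := cls (coherentM (rep_coherent a) (rep_coherent b)).
Definition lim_star a : L := cls (coherent_star (rep_coherent a)).

Lemma lim_addE x y (cx : coherent x) (cy : coherent y) :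
  lim_add (cls cx) (cls cy) = cls (coherentD cx cy).
Proof.
apply: cls_eq; apply: null_ext (nullD (null_rep cx) (null_rep cy)) => n.
by rewrite /subf /addf /oppf opprD addrACA.
Qed.

Lemma lim_oppE x (cx : coherent x) : lim_opp (cls cx) = cls (coherentN cx).
Proof.
apply: cls_eq; apply: null_ext (nullN (null_rep cx)) => n.
by rewrite /subf /addf /oppf opprD.
Qed.

Lemma lim_scaleE k x (cx : coherent x) :
  lim_scale k (cls cx) = cls (coherentZ k cx).
Proof.
apply: cls_eq; apply: null_ext (nullZ k (null_rep cx)) => n.
by rewrite /subf /addf /oppf /scalef scalerBr.
Qed.

Lemma lim_smulE x y (cx : coherent x) (cy : coherent y) :
  lim_smul (cls cx) (cls cy) = cls (coherentM cx cy).
Proof.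
have [M M0 xM] := coherent_bounded (rep_coherent (cls cx)).
have [N N0 yN] := coherent_bounded cy.
have [h1 _] := nullM_bounded M0 xM (null_rep cy).
have [_ h2] := nullM_bounded N0 yN (null_rep cx).
apply: cls_eq; apply: null_ext (nullD h1 h2) => n.
by rewrite /subf /addf /oppf /mulf smulBr smulBl addrA subrK.
Qed.

Lemma lim_starE x (cx : coherent x) : lim_star (cls cx) = cls (coherent_star cx).
Proof.
apply: cls_eq; apply: null_ext (null_star (null_rep cx)) => n.
by rewrite /subf /addf /oppf /starf starB.
Qed.

Lemma cls_ext x y (cx : coherent x) (cy : coherent y) :
  (forall n, x n = y n) -> cls cx = cls cy.
Proof.
move=> xy; apply: cls_eq; apply: null_ext (null_sub_self x) => n.
by rewrite /subf /addf /oppf xy.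
Qed.

Fact lim_addA : associative lim_add.
Proof.
move=> a b c; rewrite (rep_cls a) (rep_cls b) (rep_cls c) !lim_addE.
by apply: cls_ext => n; exact: addrA.
Qed.

Fact lim_addC : commutative lim_add.
Proof.
move=> a b; rewrite (rep_cls a) (rep_cls b) !lim_addE.
by apply: cls_ext => n; exact: addrC.
Qed.

Fact lim_add0 : left_id lim_zero lim_add.
Proof.
move=> a; rewrite (rep_cls a) lim_addE.
by apply: cls_ext => n; exact: add0r.
Qed.

Fact lim_addN : left_inverse lim_zero lim_opp lim_add.
Proof.
move=> a; rewrite (rep_cls a) lim_oppE lim_addE.
by apply: cls_ext => n; exact: addNr.
Qed.

HB.instance Definition _ := GRing.isZmodule.Build L
  lim_addA lim_addC lim_add0 lim_addN.

Fact lim_scaleA k l a : lim_scale k (lim_scale l a) = lim_scale (k * l) a.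
Proof.
rewrite (rep_cls a) !lim_scaleE.
by apply: cls_ext => n; exact: scalerA.
Qed.

Fact lim_scale1 : left_id 1 lim_scale.
Proof.
by move=> a; rewrite (rep_cls a) lim_scaleE; apply: cls_ext => n; exact: scale1r.
Qed.

Fact lim_scaleDr : right_distributive lim_scale +%R.
Proof.
move=> k a b; rewrite (rep_cls a) (rep_cls b) [_ + _]lim_addE !lim_scaleE.
by rewrite [RHS]lim_addE; apply: cls_ext => n; exact: scalerDr.
Qed.

Fact lim_scaleDl a : {morph lim_scale^~ a : k l / k + l}.
Proof.
move=> k l /=; rewrite (rep_cls a) !lim_scaleE [RHS]lim_addE.
by apply: cls_ext => n; exact: scalerDl.
Qed.

HB.instance Definition _ := GRing.Zmodule_isLmodule.Build R[i] L
  lim_scaleA lim_scale1 lim_scaleDr lim_scaleDl.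

Fact lim_smulA : associative lim_smul.
Proof.
move=> a b c; rewrite (rep_cls a) (rep_cls b) (rep_cls c) !lim_smulE.
by apply: cls_ext => n; exact: smulA.
Qed.

Fact lim_smulDl : left_distributive lim_smul +%R.
Proof.
move=> a b c; rewrite (rep_cls a) (rep_cls b) (rep_cls c) [_ + _]lim_addE.
by rewrite !lim_smulE [RHS]lim_addE; apply: cls_ext => n; exact: smulDl.
Qed.

Fact lim_smulDr : right_distributive lim_smul +%R.
Proof.
move=> a b c; rewrite (rep_cls a) (rep_cls b) (rep_cls c) [_ + _]lim_addE.
by rewrite !lim_smulE [RHS]lim_addE; apply: cls_ext => n; exact: smulDr.
Qed.

Fact lim_smulZl (k : R[i]) a b : lim_smul (k *: a) b = k *: lim_smul a b.
Proof.
rewrite (rep_cls a) (rep_cls b) [_ *: _]lim_scaleE !lim_smulE [RHS]lim_scaleE.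
by apply: cls_ext => n; exact: smulZl.
Qed.

Fact lim_smulZr (k : R[i]) a b : lim_smul a (k *: b) = k *: lim_smul a b.
Proof.
rewrite (rep_cls a) (rep_cls b) [_ *: _]lim_scaleE !lim_smulE [RHS]lim_scaleE.
by apply: cls_ext => n; exact: smulZr.
Qed.

Fact lim_starK : involutive lim_star.
Proof.
by move=> a; rewrite (rep_cls a) !lim_starE; apply: cls_ext => n; exact: starK.
Qed.

Fact lim_starD : {morph lim_star : a b / a + b}.
Proof.
move=> a b; rewrite (rep_cls a) (rep_cls b) [_ + _]lim_addE !lim_starE.
by rewrite [RHS]lim_addE; apply: cls_ext => n; exact: starD.
Qed.

Fact lim_starZ (k : R[i]) a : lim_star (k *: a) = Num.conj k *: lim_star a.
Proof.
rewrite (rep_cls a) [_ *: _]lim_scaleE !lim_starE [RHS]lim_scaleE.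
by apply: cls_ext => n; exact: starZ.
Qed.

Fact lim_starM a b : lim_star (lim_smul a b) = lim_smul (lim_star b) (lim_star a).
Proof.
rewrite (rep_cls a) (rep_cls b) lim_smulE !lim_starE lim_smulE.
by apply: cls_ext => n; exact: starM.
Qed.

HB.instance Definition _ := Lmodule_isStarAlgebra.Build R L
  lim_smulA lim_smulDl lim_smulDr lim_smulZl lim_smulZr
  lim_starK lim_starD lim_starZ lim_starM.

Definition lim_norm a : R[i] := (limnorm (rep a))%:C.

Lemma lim_normE x (cx : coherent x) : lim_norm (cls cx) = (limnorm x)%:C.
Proof.
congr (_%:C); apply/le_anti/andP; split; apply: limnorm_null => //.
- exact: rep_coherent.
- exact: null_rep.
- exact: rep_coherent.
- by apply: null_swap; exact: null_rep.
Qed.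

Fact lim_ler_normD a b : lim_norm (a + b) <= lim_norm a + lim_norm b.
Proof.
rewrite (rep_cls a) (rep_cls b) [_ + _]lim_addE !lim_normE -rmorphD lecR.
by apply: limnormD; exact: rep_coherent.
Qed.

Fact lim_normrZ (k : R[i]) a : lim_norm (k *: a) = `|k| * lim_norm a.
Proof.
rewrite (rep_cls a) [_ *: _]lim_scaleE !lim_normE limnormZ; last exact: rep_coherent.
by rewrite rmorphM/= -normc_ge0.
Qed.

Fact lim_normr0_eq0 a : lim_norm a = 0 -> a = 0.
Proof.
move=> /complexI a0; rewrite (rep_cls a); apply: cls_eq.
apply: null_ext (limnorm_eq0 (rep_coherent a) a0) => n.
by rewrite /subf /addf /oppf /zerof subr0.
Qed.

HB.instance Definition _ := Lmodule_isNormed.Build R[i] L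
  lim_ler_normD lim_normrZ lim_normr0_eq0.

Lemma nrm_cls x (cx : coherent x) : nrm (cls cx) = limnorm x.
Proof. by rewrite /nrm [`|_|]lim_normE. Qed.

End Limit.

Section Completeness.
Context (R : realType) (D : direct_system R).
Local Notation L := (limit_alg D).
Implicit Types (x y z : family D) (a b c : L).

(** Diagonal argument: the families [x k] need to be close only for indices
that are large in terms of [k], so no completeness of the algebras of the
system is involved. *)
Lemma diagonal_family (x : nat -> family D) :
  (forall k, coherent (x k)) ->
  (forall i j, (i <= j)%N -> forall e : R, 0 < e ->
     \forall n \near \oo, nrm (x i n - x j n) <= 2^-1 ^+ i + e) ->
  exists2 z, coherent z &
    forall k, \forall n \near \oo, nrm (x k n - z n) <= 2 * 2^-1 ^+ k.
Proof.
move=> cx xx; pose good n k := forall i j : nat, (i <= j)%N -> (j <= k)%N ->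
  nrm (x i n - x j n) <= 2 * 2^-1 ^+ i.
have good0 n : good n 0%N.
  move=> i j ij; rewrite leqn0 => /eqP j0; move: ij; rewrite j0 leqn0 => /eqP ->.
  by rewrite subrr nrm0 expr0 mulr1.
have near_good k : \forall n \near \oo, good n k.
  have : \forall n \near \oo, forall ij : 'I_k.+1 * 'I_k.+1, (ij.1 <= ij.2)%N ->
      nrm (x ij.1 n - x ij.2 n) <= 2 * 2^-1 ^+ ij.1.
    apply: filter_forall => -[i j] /=; have [ij|_] := leqP i j; last exact: nearW.
    have e0 : 0 < (2^-1 : R) ^+ i by rewrite exprn_gt0.
    apply: filterS (xx i j ij _ e0) => n h _; apply: le_trans h _; lra.
  apply: filterS => n h i j ij jk.
  have ik := leq_ltn_trans ij (jk : (j < k.+1)%N).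
  exact: (h (Ordinal ik, Ordinal (jk : (j < k.+1)%N))).
have /choice[K KP] n : exists K, good n K /\ forall k, (k <= n)%N -> good n k -> (k <= K)%N.
  have [||K KP Kmax] := @ex_maxnP (fun k => (k <= n)%N && `[< good n k >]) n.
  - by exists 0%N; rewrite leq0n; apply/asboolP.
  - by move=> k /andP[].
  case/andP: KP => Kn /asboolP gK; exists K; split=> // k kn gk.
  by apply: Kmax; rewrite kn; apply/asboolP.
pose z : family D := fun n => x (K n) n.
have xz k : \forall n \near \oo, nrm (x k n - z n) <= 2 * 2^-1 ^+ k.
  apply: filterS (filterI (near_good k) (nbhs_infty_ge k)) => n [gk kn].
  have [gK KM] := KP n; exact: gK (KM _ kn gk) (leqnn _).
exists z => // e e0.
have e3 : 0 < e / 6 by rewrite divr_gt0.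
have [k ke] := half_expr_small e3.
apply: filterS (filterI (near_shift (xz k)) (cx k _ e3)) => n [h1 h2] j.
have := h1 j; have := h1 0%N; rewrite [(0 + n)%N]add0n => h3 h4.
rewrite (le_trans (nrmD3 _ (x k (j + n)%N) _))// nrmB.
rewrite (le_trans (lerD h4 (nrmD3 _ (trans j (x k n)) _)))//.
rewrite -(homB (trans_hom D n j)).
have := trans_le j (x k n - z n); have := h2 j; lra.
Qed.

Fact lim_complete (F : set_system L) : ProperFilter F -> cauchy F -> cvg F.
Proof.
move=> FF /cauchyP Fc.
pose r k : R := 3^-1 * 2^-1 ^+ k.
have r0 k : 0 < r k by rewrite mulr_gt0 ?invr_gt0 ?exprn_gt0.
have /choice[c cP] k : exists c, F (ball c (r k)%:C).
  by apply: Fc; exact: complex_gt0.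
have [||z cz xz] := @diagonal_family (fun k => rep (c k)).
- by move=> k; exact: rep_coherent.
- move=> i j ij e e0.
  have cij : nrm (c i - c j) <= 2^-1 ^+ i.
    have [b [bi bj]] := filter_ex (filterI (cP i) (cP j)).
    move: bi bj; rewrite -!ball_normE /= !nrmE !ltcR => bi bj.
    rewrite (le_trans (nrmD3 _ b _))// (nrmB b).
    have rij : r j <= r i.
      by rewrite /r ler_wpM2l ?invr_ge0// ler_wiXn2l ?invr_ge0// invf_le1 ?ler1n.
    have q0 : 0 <= (2^-1 : R) ^+ i by rewrite exprn_ge0 ?invr_ge0.
    move: (ltW bi) (ltW bj) rij q0; rewrite /r.
    move: (nrm (c i - b)) (nrm (c j - b)) (2^-1 ^+ i) (2^-1 ^+ j).
    by clear=> s t q q'; lra.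
  have cE : nrm (c i - c j) = limnorm (subf (rep (c i)) (rep (c j))).
    rewrite {1}(rep_cls (c i)) {1}(rep_cls (c j)).
    by rewrite [- _]lim_oppE [_ + _]lim_addE nrm_cls.
  have csub := coherentD (rep_coherent (c i)) (coherentN (rep_coherent (c j))).
  apply: filterS (near_limnorm csub e0) => n /le_trans; apply.
  by rewrite lerD2r -/(subf _ _) -cE.
apply/cvg_ex; exists (cls cz); apply/cvg_ballP => _ /gt0_complex[e e0 ->].
have e3 : 0 < e / 3 by rewrite divr_gt0.
have [k ke] := half_expr_small e3.
have ck : nrm (cls cz - c k) <= 2 * 2^-1 ^+ k.
  rewrite nrmB {1}(rep_cls (c k)) [- _]lim_oppE [_ + _]lim_addE nrm_cls.
  by apply: limnorm_le; [rewrite mulr_ge0// exprn_ge0|exact: xz].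
apply: filterS (cP k) => b; rewrite -!ball_normE/= !nrmE !ltcR => bk.
apply: le_lt_trans (nrmD3 _ (c k) _) _.
apply: le_lt_trans (lerD ck (ltW bk)) _.
by move: e0 ke; rewrite /r; move: (2^-1 ^+ k) => q; lra.
Qed.

HB.instance Definition _ := Uniform_isComplete.Build L lim_complete.

Fact lim_norm_smul_le a b : `|a ** b| <= `|a| * `|b|.
Proof.
rewrite !nrmE -rmorphM lecR (rep_cls a) (rep_cls b) [_ ** _]lim_smulE !nrm_cls.
by apply: limnormM; exact: rep_coherent.
Qed.

Fact lim_norm_star_smul a : `|a^*s ** a| = `|a| ^+ 2.
Proof.
rewrite !nrmE -rmorphXn (rep_cls a) [_^*s]lim_starE [_ ** _]lim_smulE !nrm_cls.
by rewrite limnormSM//; exact: rep_coherent.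
Qed.

HB.instance Definition _ := isCStarNorm.Build R L
  lim_norm_smul_le lim_norm_star_smul.

End Completeness.

Section Cone.
Context (R : realType) (D : direct_system R).
Local Notation B := (obj D).
Local Notation phi := (@map_next _ D).
Local Notation L := (limit_alg D).

Definition place n (b : B n) m : B m :=
  if @eqP nat n m is ReflectT e then ecast i (B i) e b else 0.

(** The images of [b] along the system, with 0 before [b] appears. *)
Fixpoint push n (b : B n) m : B m :=
  match m with
  | 0%N => place b 0%N
  | m.+1 => if (n <= m)%N then phi (push b m) else place b m.+1
  end.

Lemma place_self n (b : B n) : place b n = b.
Proof. by rewrite /place; case: eqP => // e; rewrite (eq_irrelevance e erefl). Qed.

Lemma push_self n (b : B n) : push b n = b.
Proof. by case: n b => [|n] b /=; rewrite ?ltnn place_self. Qed.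

Lemma pushS n (b : B n) m : (n <= m)%N -> push b m.+1 = phi (push b m).
Proof. by rewrite /= => ->. Qed.

Lemma place_hom n m : is_star_hom (fun b : B n => place b m).
Proof.
rewrite /place; case: eqP => [e|_]; first by case: m / e.
split=> [c x y|x y|x].
- by rewrite scaler0 addr0.
- by rewrite smul0l.
- by rewrite star0.
Qed.

Lemma push_hom n m : is_star_hom (fun b : B n => push b m).
Proof.
elim: m => [|m IH]; first exact: place_hom.
rewrite /=; case: (n <= m)%N; last exact: place_hom.
exact: (star_hom_comp IH (@map_hom _ D m)).
Qed.

Lemma push_trans n (b : B n) m k : (n <= m)%N ->
  push b (k + m)%N = trans k (push b m).
Proof.
move=> nm; elim: k => [//|k IH].
by rewrite [LHS]pushS ?IH// (leq_trans nm)// leq_addl.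
Qed.

Lemma push_coherent n (b : B n) : coherent (push b).
Proof.
move=> e e0; exists n => // m nm k.
by rewrite push_trans// subrr nrm0 ltW.
Qed.

Definition cone n (b : B n) : L := cls (push_coherent b).

Lemma cone_hom n : is_star_hom (@cone n).
Proof.
split.
- move=> c x y; rewrite [c *: cone x]lim_scaleE [RHS]lim_addE.
  by apply: cls_ext => m; have [-> _ _] := push_hom n m.
- move=> x y; rewrite [RHS]lim_smulE.
  by apply: cls_ext => m; rewrite (homM (push_hom n m)).
- move=> x; rewrite [RHS]lim_starE.
  by apply: cls_ext => m; rewrite (hom_star (push_hom n m)).
Qed.

Lemma cone_next n (b : B n) : cone (phi b) = cone b.
Proof.
apply: cls_eq => e e0; exists n.+1 => // m /= nm.
suff E : push (phi b) m = push b m by rewrite /subf /addf /oppf E subrr nrm0 ltW.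
rewrite -(subnK nm) !push_trans//.
by rewrite push_self pushS// push_self.
Qed.

(** An idempotent of the limit is represented by elements that are eventually
almost idempotent, hence small. *)
Lemma limit_no_idempotent :
  (forall n (p : B n), p ** p = p -> p = 0) -> forall p : L, p ** p = p -> p = 0.
Proof.
move=> noid p; rewrite {1 2 3}(rep_cls p) [_ ** _]lim_smulE => /cls_null npp.
rewrite (rep_cls p); apply: cls_eq => e e0.
pose d := Num.min 16^-1 (e / 8).
have d0 : 0 < d by rewrite lt_min invr_gt0 divr_gt0//= ltr0n.
apply: filterS (npp d d0) => n; rewrite /subf /addf /oppf /zerof /mulf subr0.
rewrite le_min => /andP[h1 h2].
rewrite (le_trans (near_idempotent (noid n) h1))//.
by rewrite mulrC -ler_pdivlMr.
Qed.

Section Universal.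
Context (A : cstarAlgType R) (mu : forall n, B n -> A).
Arguments mu : clear implicits.
Context (mu_hom : forall n, is_star_hom (mu n)).
Context (mu_next : forall n (b : B n), mu n.+1 (phi b) = mu n b).

Lemma mu_trans n k (b : B n) : mu (k + n)%N (trans k b) = mu n b.
Proof. by elim: k => [//|k IH]; exact: etrans (mu_next _) IH. Qed.

Definition limval (x : family D) (l : A) :=
  forall e : R, 0 < e -> \forall n \near \oo, nrm (mu n (x n) - l) <= e.

Lemma limval_exists (x : family D) : coherent x -> exists l, limval x l.
Proof.
move=> cx; have [|l lP] := @cauchy_lim R A (fun n => mu n (x n)).
  move=> e e0; have e2 : 0 < e / 2 by rewrite divr_gt0.
  have [N _ /(_ N (leqnn N)) /= xN] := cx _ e2.
  exists N => n Nn; rewrite -(subnK Nn) -(mu_trans (n - N) (x N)).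
  rewrite -(homB (mu_hom _)) (le_lt_trans (star_hom_contractive (mu_hom _) _))//.
  by rewrite (le_lt_trans (xN _))//; lra.
exists l => e /lP[N lN]; exists N => // n /= /lN; exact: ltW.
Qed.

Lemma limval_unique x l m : limval x l -> limval x m -> l = m.
Proof.
move=> xl xm; apply/subr0_eq/nrm_small_eq0 => e e0.
have e2 : 0 < e / 2 by rewrite divr_gt0.
have [n [h1 h2]] := filter_ex (filterI (xl _ e2) (xm _ e2)).
rewrite (le_trans (nrmD3 _ (mu n (x n)) _))// nrmB; lra.
Qed.

Lemma limval_null x y l : null (subf x y) -> limval x l -> limval y l.
Proof.
move=> nxy xl e e0; have e2 : 0 < e / 2 by rewrite divr_gt0.
apply: filterS2 (nxy _ e2) (xl _ e2) => n h1 h2.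
rewrite (le_trans (nrmD3 _ (mu n (x n)) _))// nrmB -(homB (mu_hom n)).
by have := star_hom_contractive (mu_hom n) (x n - y n); rewrite /subf /addf /oppf in h1; lra.
Qed.

Lemma limvalD x y l m : limval x l -> limval y m -> limval (addf x y) (l + m).
Proof.
move=> xl ym e e0; have e2 : 0 < e / 2 by rewrite divr_gt0.
apply: filterS2 (xl _ e2) (ym _ e2) => n h1 h2.
rewrite /addf (homD (mu_hom n)) opprD addrACA.
rewrite (le_trans (nrmD _ _))//; lra.
Qed.

Lemma limvalZ c x l : limval x l -> limval (scalef c x) (c *: l).
Proof.
move=> xl e e0; have c1 : 0 < complex.Re `|c| + 1 by rewrite ltr_wpDl// Re_norm_ge0.
have e1 : 0 < e / (complex.Re `|c| + 1) by rewrite divr_gt0.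
apply: filterS (xl _ e1) => n h.
rewrite /scalef (homZ (mu_hom n)) -scalerBr nrmZ_Re.
rewrite (le_trans (ler_wpM2l (Re_norm_ge0 c) h))//.
rewrite mulrCA ger_pMr// ler_pdivrMr// mul1r; lra.
Qed.

Lemma limval_star x l : limval x l -> limval (starf x) l^*s.
Proof.
move=> xl e e0; apply: filterS (xl e e0) => n.
by rewrite /starf (hom_star (mu_hom n)) -starB nrm_star.
Qed.

Lemma limvalM x y l m : limval x l -> limval y m -> limval (mulf x y) (l ** m).
Proof.
move=> xl ym e e0.
pose K := nrm l + nrm m + 2; have K0 : 0 < K.
  by rewrite ltr_wpDl// addr_ge0// nrm_ge0.
pose d := Num.min 1 (e / K).
have d0 : 0 < d by rewrite lt_min ltr01 divr_gt0.
apply: filterS2 (xl _ d0) (ym _ d0) => n; rewrite !le_min => /andP[h1 h2] /andP[h3 h4].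
rewrite /mulf (homM (mu_hom n)).
have -> : mu n (x n) ** mu n (y n) - l ** m
  = (mu n (x n) - l) ** (mu n (y n) - m) + (mu n (x n) - l) ** m
    + l ** (mu n (y n) - m) by nc.
set u := mu n (x n) - l in h1 h2 *; set v := mu n (y n) - m in h3 h4 *.
have eK : e = (e / K) * (1 + nrm m + nrm l) + e / K.
  by rewrite /K; field; move: (gt_eqF K0); rewrite /K => ->.
have ek0 : 0 <= e / K by rewrite divr_ge0// ltW.
apply: le_trans (nrmD _ _) _; apply: le_trans (lerD (nrmD _ _) (lexx _)) _.
have g1 := nrmM u v; have g2 := nrmM u m; have g3 := nrmM l v.
rewrite eK; move: (e / K) ek0 h2 h4 => t t0 h2 h4.
have u0 := nrm_ge0 u; have v0 := nrm_ge0 v; have l0 := nrm_ge0 l; have m0 := nrm_ge0 m.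
have b1 : nrm u * nrm v <= t * 1 by apply: ler_pM.
have b2 : nrm u * nrm m <= t * nrm m by apply: ler_pM.
have b3 : nrm l * nrm v <= nrm l * t by apply: ler_pM.
lra.
Qed.

(** The map sends the class of [x] to the limit of [mu n (x n)]. *)
Lemma comparison_map : exists G : L -> A,
  is_star_hom G /\ forall n (b : B n), G (cone b) = mu n b.
Proof.
have /choice[G GP] p : exists l, limval (rep p) l.
  exact: limval_exists (rep_coherent p).
have Gcls x (cx : coherent x) : limval x (G (cls cx)).
  by apply: limval_null (GP _); exact: null_rep.
exists G; split.
  split.
  - move=> c p q; apply: limval_unique (GP _) _.
    rewrite {1}(rep_cls p) {1}(rep_cls q) [_ *: _]lim_scaleE [_ + _]lim_addE.
    apply: limval_null (limvalD (limvalZ c (GP p)) (GP q)).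
    by apply: null_swap; exact: null_rep.
  - move=> p q; apply: limval_unique (GP _) _.
    rewrite {1}(rep_cls p) {1}(rep_cls q) [_ ** _]lim_smulE.
    apply: limval_null (limvalM (GP p) (GP q)).
    by apply: null_swap; exact: null_rep.
  - move=> p; apply: limval_unique (GP _) _.
    rewrite {1}(rep_cls p) [_^*s]lim_starE.
    apply: limval_null (limval_star (GP p)).
    by apply: null_swap; exact: null_rep.
move=> n b; apply: limval_unique (Gcls _ _) _ => e e0.
exists n => // m /= nm; rewrite -(subnK nm) push_trans// push_self mu_trans.
by rewrite subrr nrm0 ltW.
Qed.

End Universal.
End Cone.

(** By uniqueness in the universal property, the map from [A] to the concrete
limit followed by the comparison map is the identity, so [A] embeds into the
concrete limit. *)
Lemma inductive_limit_no_idempotent (R : realType) (B : nat -> cstarAlgType R)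
    (phi : forall n, B n -> B n.+1) (A : cstarAlgType R)
    (mu : forall n, B n -> A) :
  (forall n, is_star_hom (phi n)) -> is_inductive_limit phi mu ->
  (forall n (p : B n), p ** p = p -> p = 0) -> forall p : A, p ** p = p -> p = 0.
Proof.
move=> phiH [muH mu_next univ] noid p pp.
pose D := DirectSystem phiH.
have [f [[fH fcone] _]] := univ (limit_alg D) (@cone R D) (@cone_hom R D) (@cone_next R D).
have [G [GH Gcone]] := @comparison_map R D A mu muH mu_next.
have [h [[_ _] huniq]] := univ A mu muH mu_next.
have h1 : h = (fun x => x) by apply: huniq; split=> //; exact: star_hom_id.
have h2 : h = (fun x => G (f x)).
  apply: huniq; split; first exact: star_hom_comp fH GH.
  by move=> n b; rewrite fcone Gcone.
have -> : p = G (f p) by rewrite -[RHS]/((fun x => G (f x)) p) -h2 h1.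
rewrite (@limit_no_idempotent R D noid (f p)) ?(hom0 GH)//.
by rewrite -(homM fH) pp.
Qed.

(** * Building blocks have no idempotents *)

Section Blocks.
Context (R : realType).

Section Point.
Context (Y : topologicalType) (k : nat) (P : matrix_alg k (C0 R Y)).
Context (PP : P ** P = P).

Definition entry (i j : 'I_k) (y : Y) : R[i]^o := val ((P : 'M[C0 R Y]_k) i j) y.

Lemma entryM i j y : entry i j y = \sum_l entry i l y * entry l j y.
Proof.
rewrite /entry -{1}PP mxE.
by apply: (big_morph (fun f : C0 R Y => val f y)).
Qed.

(** The sum [s] of the moduli of the entries of an idempotent matrix satisfies
[s <= s^2], so it cannot be small without being 0. *)
Lemma idempotent_gap y : (exists i j, entry i j y != 0) ->
  exists i j, ((k * k).+1%:R)^-1 <= `|entry i j y|.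
Proof.
move=> [i0 [j0 ij0]]; pose a i j := `|entry i j y|; pose s := \sum_i \sum_j a i j.
have a0 i j : 0 <= a i j by exact: normr_ge0.
have sa i j : a i j <= s.
  rewrite /s (bigD1 i)//= (bigD1 j)//= -addrA lerDl addr_ge0// ?sumr_ge0// => *.
  by rewrite sumr_ge0.
have s0 : 0 < s by apply: lt_le_trans (sa i0 j0); rewrite normr_gt0.
have ss : s <= s * s.
  rewrite {2}/s mulr_suml; apply: ler_sum => i _.
  rewrite mulr_suml.
  have -> : \sum_j a i j = \sum_j `|\sum_l entry i l y * entry l j y|.
    by apply: eq_bigr => j _; rewrite -entryM.
  rewrite (@le_trans _ _ (\sum_j \sum_l a i l * a l j))//.
    apply: ler_sum => j _; rewrite (le_trans (ler_norm_sum _ _ _))//.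
    by apply: ler_sum => l _; rewrite normrM.
  rewrite exchange_big/=; apply: ler_sum => l _.
  rewrite -mulr_sumr ler_wpM2l// /s [leRHS](bigD1 l)//= lerDl sumr_ge0// => *.
  by rewrite sumr_ge0.
have s1 : 1 <= s by rewrite -(ler_pM2l s0) mulr1.
apply: contrapT => small; have lt i j : a i j <= ((k * k).+1%:R)^-1.
  have rr : ((k * k).+1%:R)^-1 \is @Num.real R[i] by rewrite realV realn.
  have [//|h] := real_leP (normr_real (entry i j y)) rr.
  by case: small; exists i, j; exact: ltW.
have : s <= \sum_(i < k) \sum_(j < k) ((k * k).+1%:R)^-1.
  by apply: ler_sum => i _; apply: ler_sum => j _; exact: lt.
rewrite !sumr_const !card_ord -mulrnA -[_ *+ (k * k)]mulr_natl => /(le_trans s1).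
by rewrite ler_pdivlMr ?ltr0n// mul1r ler_nat ltnn.
Qed.

End Point.

(** An idempotent takes its nonzero values on a set that is compact, by the gap,
and open; in the connected space [X] this set misses [x0], so it is empty. *)
Lemma block_no_idempotent (X : metricType R) (x0 : X) k
    (P : matrix_alg k (C0 R (punctured x0))) :
  compact [set: X] -> connected [set: X] -> P ** P = P -> P = 0.
Proof.
move=> cX conX PP; pose Z := [set y | exists i j, entry P i j y != 0].
pose K ij := [set y | ((k * k).+1%:R)^-1 <= `|entry P ij.1 ij.2 y|].
have van i j : vanishing_at_infinity (entry P i j) by exact: (asboolW (valP ((P : 'M[C0 R (punctured x0)]_k) i j))).
have d0 : 0 < ((k * k).+1%:R)^-1 :> R[i] by rewrite invr_gt0 ltr0n.
have ZK : Z = \big[setU/set0]_(ij : 'I_k * 'I_k) K ij.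
  rewrite -bigcup_seq; apply/seteqP; split=> y.
    move=> /(idempotent_gap PP)[i [j ij]]; exists (i, j) => //=.
    by rewrite mem_index_enum.
  move=> [[i j] _ /= ij]; exists i, j.
  by rewrite -normr_gt0; exact: lt_le_trans ij.
have cZ : compact Z.
  by rewrite ZK; apply: bigsetU_compact => -[i j] _; have [_] := van i j; apply.
have oZ : open Z.
  have -> : Z = \bigcup_(ij in [set: 'I_k * 'I_k]) (entry P ij.1 ij.2 @^-1` ~` [set 0]).
    apply/seteqP; split=> y.
      by move=> [i [j ij]]; exists (i, j) => //=; apply/eqP.
    by move=> [[i j] _ /= /eqP ij]; exists i, j.
  apply: bigcup_open => -[i j] _ /=; apply: open_comp.
    by move=> y _; have [cont _] := van i j; exact: cont.
  apply: closed_openC; apply: accessible_closed_set1.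
  by apply: hausdorff_accessible; exact: norm_hausdorff.
have T2 := @metric_hausdorff R X.
pose W := set_val @` Z : set X.
have cW : compact W.
  apply: continuous_compact => //; apply: continuous_subspaceT.
  exact: initial_continuous.
have clW : closed W by exact: compact_closed.
have oW : open W.
  have [C oC CZ] := oZ.
  have -> : W = C `&` ~` [set x0].
    apply/seteqP; split=> x.
      move=> [y Zy <-]; split; last exact: set_valP.
      by move: Zy; rewrite -CZ.
    move=> [Cx xx0]; exists (SigSub (mem_set xx0)) => //.
    by rewrite -CZ.
  apply: openI => //; apply: closed_openC.
  by apply: accessible_closed_set1; exact: hausdorff_accessible.
have nW : ~ (W !=set0).
  move=> W0; have WT : W = [set: X].
    by apply: (conX W W0); exists W; rewrite ?setTI.
  have : W x0 by rewrite WT.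
  by move=> [y _ yx0]; exact: (set_valP y).
apply/matrixP => i j; rewrite mxE; apply/val_inj/funext => y.
apply: contrapT => /eqP ij; apply: nW; exists (set_val y), y => //.
by exists i, j.
Qed.

Lemma AH0_block_no_idempotent (B : cstarAlgType R) : is_AH0_block B ->
  forall p : B, p ** p = p -> p = 0.
Proof.
move=> [m [k [X [x0 [_ cX conX [f [fH /bij_inj finj]]]]]]] p pp.
apply: finj; rewrite (hom0 fH); apply: functional_extensionality_dep => i.
apply: block_no_idempotent => //.
by have := homM fH p p; rewrite pp => fp; rewrite {3}fp.
Qed.

End Blocks.

Lemma AH0_no_idempotent (R : realType) (A : cstarAlgType R) : is_AH0 A ->
  forall p : A, p ** p = p -> p = 0.
Proof.
move=> [B [phi [mu [blocks phiH lim]]]].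
by apply: (inductive_limit_no_idempotent phiH lim) => n; exact: AH0_block_no_idempotent.
Qed.

Lemma infinite_projection_neq0 (R : realType) (A : cstarAlgType R) (p : A) :
  infinite_projection p -> p != 0.
Proof.
move=> [_ [q [_ _ qp [v [vp vq]]]]]; apply/eqP => p0; apply: qp.
by rewrite p0 -vq (starM_eq0 (etrans vp p0)) smul0l.
Qed.

Lemma infinite_projection_matrix (R : realType) (A : starAlgType R) (p : A) :
  infinite_projection p ->
  infinite_projection (\matrix_(i, j) p : matrix_alg 1 A).
Proof.
pose M (x : A) : matrix_alg 1 A := \matrix_(i, j) x.
have MM x y : M x ** M y = M (x ** y).
  by apply/matrixP => i j; rewrite !mxE big_ord1 !mxE.
have MS x : (M x)^*s = M x^*s by apply/matrixP => i j; rewrite !mxE.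
move=> [[pp sp] [q [[qq sq] pq qp [v [vp vq]]]]]; split.
  by split; rewrite -/(M p) ?MM ?MS ?pp ?sp.
exists (M q); rewrite -/(M p); split.
- by split; rewrite ?MM ?MS ?qq ?sq.
- by rewrite /subprojection MM pq.
- by move=> /matrixP/(_ ord0 ord0); rewrite !mxE.
- by exists (M v); rewrite !MS !MM vp vq.
Qed.

Theorem theorem7p1 (R : realType) :
  ~ (exists A : cstarAlgType R,
       [/\ nonzero_alg A, noetherian A, separable_space A, purely_infinite A
         & stably_finite A]) /\
  ~ (exists A : cstarAlgType R,
       [/\ nonzero_alg A, noetherian A, purely_infinite A & is_AH0 A]).
Proof.
split=> [[A [A0 nA _ piA finA]]|[A [A0 nA piA AH0]]].
  have [p pinf] := noetherian_infinite_projection A0 nA piA.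
  by apply: (finA 1%N); exists (\matrix_(i, j) p); exact: infinite_projection_matrix.
have [p pinf] := noetherian_infinite_projection A0 nA piA.
case/eqP: (infinite_projection_neq0 pinf).
by apply: (AH0_no_idempotent AH0); have [[]] := pinf.
Qed.
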